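(* Let $\pi\colon M\to B$ be a holomorphic Lagrangian fibration on a compact simply connected hyperkähler manifold $M$ of maximal holonomy, and let $\mathcal{M}_t=(M,I_t)$, $t\in\mathbb{C}$, be the corresponding degenerate twistor deformation. Then $\mathcal{M}_t$ admits a Hermitian symplectic structure for all $t\in\mathbb{C}$.
   Context: A hyperkähler manifold is a compact complex manifold of Kähler type admitting a closed, non-degenerate holomorphic 2-form $\Omega$. It is of maximal holonomy if its complex structure is parallel for a Riemannian metric on $M$ whose Levi-Civita connection has holonomy group isomorphic to $Sp(n)$, where $\dim_{\mathbb{C}}M=2n$. A holomorphic Lagrangian fibration on such an $M$ is a surjective holomorphic map $\pi\colon M\to B$ to a complex variety $B$ with $0<\dim B<\dim M$ (by Matsushita's theorem then $\dim B=\frac12\dim M$ and the fibers are holomorphic Lagrangian). The base $B$ is projective. C-symplectic forms: on a real $4n$-dimensional smooth manifold, a C-symplectic form is a smooth complex-valued 2-form $\Omega$ with $d\Omega=0$, $\Omega^{n+1}=0$ and $\Omega^n\wedge\overline{\Omega}^n$ nowhere vanishing. It determines a unique integrable complex structure for which $T^{0,1}M=\{v\in TM\otimes\mathbb{C} : \Omega(v,\cdot)=0\}$, and $\Omega$ is then a holomorphic symplectic form. Degenerate twistor deformation: let $\eta$ be the $(1,1)$-form on $B$ obtained by restricting the Fubini–Study form under some projective embedding of $B$ (so $\pi^*\eta$ is the pullback of the Fubini–Study form under $M\to B\hookrightarrow\mathbb{P}^N$). For every $t\in\mathbb{C}$ the form $\Omega_t=\Omega+t\pi^*\eta$ is C-symplectic;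 let $I_t$ be the corresponding complex structure on $M$. The manifolds $\mathcal{M}_t=(M,I_t)$ are the fibers of a smooth holomorphic family over $\mathbb{C}$, called the degenerate twistor deformation of $M$ associated with $\pi$. A Hermitian symplectic structure on a complex manifold $(M,I)$ is a real symplectic form $\omega$ with $\omega(v,Iv)>0$ for every non-zero tangent vector $v$; equivalently, a real symplectic form whose $(1,1)$-part $\omega^{1,1}$ is a Hermitian form. *)

(* Defs.v *)
From HB Require Import structures.
From mathcomp Require Import all_boot all_order all_algebra.
From mathcomp Require Import complex.
From mathcomp Require Import all_classical all_reals all_analysis.
From mathcomp Require mpoly.

Set Implicit Arguments.
Unset Strict Implicit.
Unset Printing Implicit Defensive.

Import Order.TTheory GRing.Theory Num.Theory.
Import numFieldNormedType.Exports.

Local Open Scope classical_set_scope.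
Local Open Scope ring_scope.

(** * Smooth maps between open subsets of normed spaces *)

(** For open [U], existence and continuity of all iterated directional
    derivatives up to order [k] is the usual C^k condition. *)
Fixpoint Ck_on (R : realType) (V W : normedModType R) (k : nat) (U : set V)
    (f : V -> W) : Prop :=
  (forall x, U x -> {for x, continuous f}) /\
  (if k is k'.+1 then
     forall v : V, (forall x, U x -> derivable f x v) /\ Ck_on k' U ('D_v f)
   else True).

Definition smooth_on (R : realType) (V W : normedModType R) (U : set V)
    (f : V -> W) : Prop := forall k, Ck_on k U f.

(** * Smooth manifolds *)

Record chart (R : realType) (d : nat) (T : topologicalType) := Chart {
  dom : set T;
  coords : T -> 'rV[R]_d;
  param : 'rV[R]_d -> T;
  open_dom : open dom;
  open_chart_image : open (coords @` dom);
  coordK : forall p, dom p -> param (coords p) = p;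
  continuous_coord : forall p, dom p -> {for p, continuous coords};
  continuous_param : forall x, (coords @` dom) x -> {for x, continuous param}
}.

Definition chart_image (R : realType) d T (c : chart R d T) : set 'rV[R]_d :=
  coords c @` dom c.

Definition transition (R : realType) d T (c c' : chart R d T) :
  'rV[R]_d -> 'rV[R]_d := coords c' \o param c.

Definition smooth_compatible (R : realType) d T (c c' : chart R d T) : Prop :=
  smooth_on (coords c @` (dom c `&` dom c')) (transition c c') /\
  smooth_on (coords c' @` (dom c `&` dom c')) (transition c' c).

(** [chart_at p] is a preferred chart around [p].  It trivialises the tangent
    space: a tangent vector at [p] is its row of components in [chart_at p]. *)
Record manifold (R : realType) (d : nat) := Manifold {
  points :> topologicalType;
  manifold_hausdorff : hausdorff_space points;
  manifold_second_countable : @second_countable points;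
  atlas : set (chart R d points);
  atlas_compatible : forall c c', atlas c -> atlas c' -> smooth_compatible c c';
  chart_at : points -> chart R d points;
  chart_at_atlas : forall p, atlas (chart_at p);
  chart_at_dom : forall p, dom (chart_at p) p
}.

Section Tensors.
Variables (R : realType) (d : nat) (M : manifold R d).

(** The charts of the maximal atlas. *)
Definition smooth_chart (c : chart R d M) : Prop :=
  forall c', atlas c' -> smooth_compatible c c'.

(** A tangent vector at [p] with components [v] in the chart [c] has components
    [v *m frame c p] in [chart_at p], i.e. is the element [v *m frame c p] of
    the tangent space at [p]. *)
Definition frame (c : chart R d M) (p : M) : 'M[R]_d :=
  jacobian (transition c (chart_at p)) (coords c p).

(** Matrix conventions: a bilinear form [w] on the tangent space at [p] is the
    matrix with [w(u, v) = bil (w p) u v]; an endomorphism [I] acts on rows by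
    [v |-> v *m I p].  [bil_in] and [endo_in] are the component matrices of such
    fields in a chart. *)
Definition bil (A : 'M[R]_d) (u v : 'rV[R]_d) : R := (u *m A *m v^T) 0 0.

Definition bil_in (c : chart R d M) (w : M -> 'M[R]_d) (x : 'rV[R]_d) :
  'M[R]_d :=
  let p := param c x in frame c p *m w p *m (frame c p)^T.

Definition endo_in (c : chart R d M) (I : M -> 'M[R]_d) (x : 'rV[R]_d) :
  'M[R]_d :=
  let p := param c x in frame c p *m I p *m invmx (frame c p).

Definition smooth_bil (w : M -> 'M[R]_d) : Prop :=
  forall c, smooth_chart c -> smooth_on (chart_image c) (bil_in c w).

Definition e_ (i : 'I_d) : 'rV[R]_d := delta_mx 0 i.

(** Smooth real 2-forms, and [d w = 0] in coordinates. *)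
Definition two_form (w : M -> 'M[R]_d) : Prop :=
  smooth_bil w /\ forall p, (w p)^T = - w p.

Definition closed_form (w : M -> 'M[R]_d) : Prop :=
  forall c, smooth_chart c -> forall x, chart_image c x -> forall i j k,
    'D_(e_ i) (fun y => bil_in c w y j k : R) x
    + 'D_(e_ j) (fun y => bil_in c w y k i : R) x
    + 'D_(e_ k) (fun y => bil_in c w y i j : R) x = 0.

Definition symplectic (w : M -> 'M[R]_d) : Prop :=
  [/\ two_form w, closed_form w & forall p, w p \in unitmx].

(** Complex-valued forms are treated through their real and imaginary parts. *)
Definition re_part (Om : M -> 'M[R[i]]_d) (p : M) : 'M[R]_d :=
  map_mx (@complex.Re R) (Om p).
Definition im_part (Om : M -> 'M[R[i]]_d) (p : M) : 'M[R]_d :=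
  map_mx (@complex.Im R) (Om p).
Definition to_complex m n : 'M[R]_(m, n) -> 'M[R[i]]_(m, n) :=
  map_mx (real_complex R).

Definition complex_two_form (Om : M -> 'M[R[i]]_d) : Prop :=
  two_form (re_part Om) /\ two_form (im_part Om).
Definition complex_closed_form (Om : M -> 'M[R[i]]_d) : Prop :=
  closed_form (re_part Om) /\ closed_form (im_part Om).

(** Functions on open subsets of [M]; their differentials. *)
Definition smooth_fun (U : set M) (f : M -> R) : Prop :=
  forall c, smooth_chart c ->
    smooth_on (coords c @` (dom c `&` U)) (fun x => f (param c x) : R).

Definition dfun (f : M -> R) (p : M) (v : 'rV[R]_d) : R :=
  'D_v (fun x => f (param (chart_at p) x) : R) (coords (chart_at p) p).

Definition cdfun (f : M -> R[i]) (p : M) (v : 'rV[R]_d) : R[i] :=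
  Complex (dfun (fun q => complex.Re (f q)) p v)
          (dfun (fun q => complex.Im (f q)) p v).

(** * Riemannian metrics, Levi-Civita connection, holonomy *)

Definition riemannian_metric (g : M -> 'M[R]_d) : Prop :=
  [/\ smooth_bil g, forall p, (g p)^T = g p
    & forall p v, v != 0 -> 0 < bil (g p) v v].

(** Christoffel symbols of the Levi-Civita connection (Koszul formula for
    vector fields with constant components [v], [w] in the chart [c]). *)
Definition christoffel (g : M -> 'M[R]_d) (c : chart R d M) (x v w : 'rV[R]_d) :
  'rV[R]_d :=
  let G := bil_in c g in
  (\row_k (2^-1 * ('D_v (fun y => bil (G y) w (e_ k) : R) x
                   + 'D_w (fun y => bil (G y) v (e_ k) : R) x
                   - 'D_(e_ k) (fun y => bil (G y) v w : R) x)))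
  *m invmx (G x).

(** Components at [x] of the covariant derivative along [v] of the vector field
    with components [Y] in the chart [c]. *)
Definition nabla (g : M -> 'M[R]_d) (c : chart R d M) (v : 'rV[R]_d)
    (Y : 'rV[R]_d -> 'rV[R]_d) (x : 'rV[R]_d) : 'rV[R]_d :=
  'D_v Y x + christoffel g c x v (Y x).

Definition parallel_endo (g I : M -> 'M[R]_d) : Prop :=
  forall c, smooth_chart c -> forall x, chart_image c x ->
  forall (v : 'rV[R]_d) (Y : 'rV[R]_d -> 'rV[R]_d),
    smooth_on (chart_image c) Y ->
    nabla g c v (fun y => Y y *m endo_in c I y) x
    = nabla g c v Y x *m endo_in c I x.

Definition smooth_curve (gamma : R -> M) : Prop :=
  continuous gamma /\
  forall c, smooth_chart c ->
    @smooth_on R R 'rV[R]_d (gamma @^-1` dom c) (coords c \o gamma).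

(** [X t] is a tangent vector at [gamma t]. *)
Definition parallel_along (g : M -> 'M[R]_d) (gamma : R -> M)
    (X : R -> 'rV[R]_d) : Prop :=
  forall c, smooth_chart c -> forall t, dom c (gamma t) ->
    let Xc : R -> 'rV[R]_d := fun s => X s *m invmx (frame c (gamma s)) in
    let gc : R -> 'rV[R]_d := coords c \o gamma in
    derivable Xc t 1 /\
    'D_1 Xc t + christoffel g c (gc t) ('D_1 gc t) (Xc t) = 0.

Definition smooth_transport (g : M -> 'M[R]_d) (p q : M) (A : 'M[R]_d) : Prop :=
  exists gamma : R -> M,
    [/\ smooth_curve gamma, gamma 0 = p, gamma 1 = q &
        forall v, exists X,
          [/\ parallel_along g gamma X, X 0 = v & X 1 = v *m A]].

(** Parallel transport from [p] to [q] along piecewise smooth paths. *)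
Inductive parallel_transport (g : M -> 'M[R]_d) (p : M) :
    M -> 'M[R]_d -> Prop :=
  | PT_nil : parallel_transport g p p 1%:M
  | PT_rcons q r A B : parallel_transport g p q A ->
      smooth_transport g q r B -> parallel_transport g p r (A *m B).

Definition holonomy_group (g : M -> 'M[R]_d) (p : M) : set 'M[R]_d :=
  [set A | parallel_transport g p p A].

End Tensors.

Definition simply_connected (R : realType) (T : topologicalType) : Prop :=
  [/\ [set: T] !=set0,
      forall x y : T, exists gamma : R -> T,
        [/\ {within `[0, 1], continuous gamma}, gamma 0 = x & gamma 1 = y]
    & forall gamma : R -> T, {within `[0, 1], continuous gamma} ->
        gamma 0 = gamma 1 ->
        exists H : R * R -> T,
          [/\ {within `[0, 1]%classic `*` `[0, 1]%classic, continuous H},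
              forall s, 0 <= s <= 1 -> H (0, s) = gamma s,
              forall s, 0 <= s <= 1 -> H (1, s) = gamma 0
            & forall u, 0 <= u <= 1 ->
                H (u, 0) = gamma 0 /\ H (u, 1) = gamma 0]].

(** * Complex manifolds *)

(** Multiplication by [i] on [C^m = R^m + R^m], [(x, y) = x + i y]. *)
Definition std_J (R : realType) (m : nat) : 'M[R]_(m + m) :=
  block_mx 0 1%:M (- 1%:M) 0.

Section ComplexManifolds.
Variables (R : realType) (m : nat) (M : manifold R (m + m)).
Implicit Types I w : M -> 'M[R]_(m + m).

Definition holomorphic_chart I (c : chart R (m + m) M) : Prop :=
  smooth_chart c /\ forall x, chart_image c x -> endo_in c I x = std_J R m.

(** Integrability is built in: [M] is covered by charts with values in [C^m] in
    which [I] is multiplication by [i]. *)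
Definition complex_structure I : Prop :=
  forall p, exists c, holomorphic_chart I c /\ dom c p.

Definition holomorphic_fun I (U : set M) (f : M -> R[i]) : Prop :=
  [/\ smooth_fun U (fun q => complex.Re (f q)),
      smooth_fun U (fun q => complex.Im (f q))
    & forall p, U p -> forall v, cdfun f p (v *m I p) = 'i%C * cdfun f p v].

(** [T^{0,1}] at [p], inside the complexified tangent space. *)
Definition T01 I (p : M) : set 'rV[R[i]]_(m + m) :=
  [set v | v *m to_complex (I p) = - 'i%C *: v].

Definition kaehler_form I w : Prop :=
  [/\ symplectic w,
      forall p u v, bil (w p) (u *m I p) (v *m I p) = bil (w p) u v
    & forall p v, v != 0 -> 0 < bil (w p) v (v *m I p)].

Definition hermitian_symplectic I w : Prop :=
  symplectic w /\ forall p v, v != 0 -> 0 < bil (w p) v (v *m I p).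

(** Holomorphic 2-forms: smooth forms of type (2,0) whose coefficients in
    holomorphic coordinates are holomorphic.  [Om(e_j, e_k)] for the first [m]
    coordinate directions is the coefficient of [dz_j /\ dz_k]. *)
Definition holomorphic_two_form I (Om : M -> 'M[R[i]]_(m + m)) : Prop :=
  [/\ complex_two_form Om,
      forall p, to_complex (I p) *m Om p = 'i%C *: Om p
    & forall c, holomorphic_chart I c -> forall j k : 'I_m,
        let jj := lshift m j in let kk := lshift m k in
        holomorphic_fun I (dom c)
          (fun q => Complex (bil_in c (re_part Om) (coords c q) jj kk)
                            (bil_in c (im_part Om) (coords c q) jj kk))].

Definition nondegenerate (Om : M -> 'M[R[i]]_(m + m)) : Prop :=
  forall p (v : 'rV[R]_(m + m)), to_complex v *m Om p = 0 -> v = 0.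

(** A hyperkaehler manifold [(M, I)] together with a holomorphic symplectic
    form [Om]. *)
Definition hyperkaehler I Om : Prop :=
  [/\ compact [set: M], complex_structure I, exists w, kaehler_form I w
    & [/\ holomorphic_two_form I Om, complex_closed_form Om
        & nondegenerate Om]].

(** [I] is the complex structure determined by the C-symplectic form [Om]:
    [T^{0,1}] is the kernel of [Om].  For a closed 2-form [Om] this forces [Om]
    to be of type (2,0) and non-degenerate on [T^{1,0}], hence C-symplectic. *)
Definition determined_by (Om : M -> 'M[R[i]]_(m + m)) I : Prop :=
  complex_structure I /\
  forall p v, T01 I p v <-> v *m Om p = 0.

Definition degenerate_twistor_form (Om : M -> 'M[R[i]]_(m + m))
    (eta : M -> 'M[R]_(m + m)) (t : R[i]) (p : M) : 'M[R[i]]_(m + m) :=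
  Om p + t *: to_complex (eta p).

End ComplexManifolds.

(** * Maximal holonomy *)

(** Left multiplication by [j] on [H^n = C^n + C^n j]: the antilinear map
    [z |-> conj z *m S] of [C^(n+n)], where [S = std_J n]. *)
Definition std_K (R : realType) (n : nat) : 'M[R]_((n + n) + (n + n)) :=
  block_mx (std_J R n) 0 0 (- std_J R n).

(** [Sp(n)]: the quaternion-linear isometries of [H^n = R^(4n)]. *)
Definition Sp (R : realType) (n : nat) : set 'M[R]_((n + n) + (n + n)) :=
  [set A | [/\ A *m A^T = 1%:M, A *m std_J R (n + n) = std_J R (n + n) *m A
             & A *m std_K R n = std_K R n *m A]].
Arguments Sp : clear implicits.

(** As [Sp(n)] is compact, a continuous isomorphism is an isomorphism of
    topological groups. *)
Definition group_isomorphic (R : realType) (d : nat) (G H : set 'M[R]_d) :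
  Prop :=
  exists phi : 'M[R]_d -> 'M[R]_d,
    [/\ {within G, continuous phi},
        forall A B, G A -> G B -> phi (A *m B) = phi A *m phi B,
        {in G &, injective phi} & phi @` G = H].

Definition maximal_holonomy (R : realType) (n : nat)
    (M : manifold R ((n + n) + (n + n))) (I : M -> 'M[R]_((n + n) + (n + n))) :
  Prop :=
  exists g, [/\ riemannian_metric g, parallel_endo g I
    & forall p, group_isomorphic (Sp R n) (holonomy_group g p)].

(** * Projective varieties *)

Section Projective.
Variables (R : realType) (N : nat).

Definition proj_space : Type := {L : {vspace 'rV[R[i]]_N.+1} | \dim L == 1%N}.

Definition hom_zero (f : mpoly.mpoly N.+1 R[i]) (L : proj_space) : Prop :=
  forall u, u \in val L -> mpoly.meval (u 0) f = 0.

Definition zariski_closed (Z : set proj_space) : Prop :=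
  exists S : set (mpoly.mpoly N.+1 R[i]),
    (forall f, S f -> exists k,
        all [pred mon | mpoly.mdeg mon == k] (mpoly.msupp f)) /\
    Z = [set L | forall f, S f -> hom_zero f L].

Definition projective_variety (Z : set proj_space) : Prop :=
  [/\ zariski_closed Z, Z !=set0
    & forall A B, zariski_closed A -> zariski_closed B ->
        Z `<=` A `|` B -> Z `<=` A \/ Z `<=` B].

(** Krull dimension. *)
Definition dim_ge (Z : set proj_space) (k : nat) : Prop :=
  exists F : nat -> set proj_space,
    [/\ forall i, (i <= k)%N -> projective_variety (F i),
        forall i, (i < k)%N -> F i `<` F i.+1 & F k `<=` Z].

Definition variety_dim (Z : set proj_space) (b : nat) : Prop :=
  dim_ge Z b /\ ~ dim_ge Z b.+1.

Definition hdot (u v : 'rV[R[i]]_N.+1) : R[i] :=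
  \sum_k u 0 k * (v 0 k)^*%C.

(** The Fubini-Study form at the line of [u], up to a positive constant
    [(i/2) ddbar log |u|^2], on the images of two vectors [a], [b]. *)
Definition fubini_study (u a b : 'rV[R[i]]_N.+1) : R :=
  - complex.Im ((hdot a b * hdot u u - hdot a u * hdot u b) / hdot u u ^+ 2).

Variables (m : nat) (M : manifold R (m + m)) (I : M -> 'M[R]_(m + m)).

Definition holomorphic_lift (pi : M -> proj_space) (U : set M)
    (F : M -> 'rV[R[i]]_N.+1) : Prop :=
  (forall k, holomorphic_fun I U (fun q => F q 0 k)) /\
  (forall q, U q -> F q != 0 /\ val (pi q) = <[F q]>%VS).

Definition holomorphic_to_proj (pi : M -> proj_space) : Prop :=
  forall p, exists U F, [/\ open U, U p & holomorphic_lift pi U F].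

(** The variety [B] comes with a projective embedding; a map from the manifold
    [M] to [B] is holomorphic iff it is so as a map to projective space. *)
Definition lagrangian_fibration (B : set proj_space) (pi : M -> proj_space) :
  Prop :=
  [/\ projective_variety B, exists b, variety_dim B b /\ (0 < b < m)%N,
      holomorphic_to_proj pi & range pi = B].

(** [eta] is the pullback by [pi] of the Fubini-Study form. *)
Definition fubini_study_pullback (pi : M -> proj_space)
    (eta : M -> 'M[R]_(m + m)) : Prop :=
  forall U F, open U -> holomorphic_lift pi U F -> forall p, U p -> forall v w,
    let dF u := \row_k cdfun (fun q => F q 0 k) p u in
    bil (eta p) v w = fubini_study (F p) (dF v) (dF w).

End Projective.

(* Main.v *)
From HB Require Import structures.
Require Import Defs.
From mathcomp Require Import all_boot all_order all_algebra.
From mathcomp Require Import complex ring lra.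
From mathcomp Require Import all_classical all_reals all_analysis.

Set Implicit Arguments.
Unset Strict Implicit.
Unset Printing Implicit Defensive.

Import Order.TTheory GRing.Theory Num.Theory.
Import numFieldNormedType.Exports.

Local Open Scope classical_set_scope.
Local Open Scope ring_scope.

(** The symplectic form is written down directly: if [w] is a Kaehler form of
    [(M, I)], then [w + C eta] tames [It] for every large constant [C].

    Let [u] be a real tangent vector and [x = It u - I u].  The vector
    [u + i It u] is of type (0,1) for [It], hence is killed by [Om + t eta];
    as [Om] is of type (2,0) for [I], this reads
      [Om(x, -) = i t (eta(u, -) + i eta(It u, -))].
    If [t = 0] then [x = 0] at once.  Otherwise, the left-hand side being of type
    (1,0) for [I], comparing types on the right gives [eta(It u, -) = eta(I u, -)], so that [eta(u, It u) = eta(u, I u)],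
    which is nonnegative because [eta] is pulled back from a Kaehler form by a
    holomorphic map.  If it vanishes, the Cauchy-Schwarz inequality gives
    [eta(u, -) = 0], the right-hand side above is zero, and nondegeneracy of
    [Om] forces [It u = I u], whence [w(u, It u) = w(u, I u) > 0]
    ([degenerate_twistor_linear]).  Thus [eta(-, It -)] is positive semidefinite
    and [w(-, It -)] is positive on its null vectors.  By compactness, first of
    the sphere of directions in a chart ([near_positive]) and then of [M]
    ([near_tame]), one constant [C] makes [w + C eta] positive on all [(u, It u)].

    It remains to see that [w + C eta] is a closed smooth form, i.e. that [eta]
    is.  In terms of a local holomorphic lift [F] of [pi] to homogeneous
    coordinates, [eta] is the exterior derivative of half the imaginary part of
    [h(dF, F) / h(F, F)], where [h] is the Hermitian product ([curl_potential]);
    closedness is then the symmetry of second derivatives ([schwarz]).  To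
    express [eta], which is given in the preferred charts, in an arbitrary chart
    one needs the chain rule ([dfun_frame]), which rests on the
    differentiability of functions of class C^1
    ([C1_differentiable_real]). *)

(** * Functions of class C^k *)

Lemma Ck_on_continuous (R : realType) (V W : normedModType R) k (U : set V)
  (f : V -> W) : Ck_on k U f -> forall x, U x -> {for x, continuous f}.
Proof. by case: k => [|k] [cf _]. Qed.

Lemma Ck_onS (R : realType) (V W : normedModType R) k (U : set V)
  (f : V -> W) : Ck_on k.+1 U f -> Ck_on k U f.
Proof.
elim: k f => [f [cf _]|k IH f [cf df]]; first by split.
by split=> // v; have [dfv Cdf] := df v; split=> //; exact: IH.
Qed.

(** [Ck_on] is a condition on the germs of [f] at the points of [U]. *)
Lemma Ck_on_cover (R : realType) (V W : normedModType R) k (U : set V)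
  (f : V -> W) : (forall x, U x -> exists2 U' : set V, U' x & Ck_on k U' f) ->
  Ck_on k U f.
Proof.
elim: k f => [|k IH] f Uf;
  (split=> //; first by move=> x /Uf[U' U'x [cf _]]; exact: cf).
move=> v; split=> [x /Uf[U' U'x [_ /(_ v)[df _]]]|]; first exact: df.
by apply: IH => x /Uf[U' U'x [_ /(_ v)[_ Cdf]]]; exists U'.
Qed.

Lemma Ck_on_eq (R : realType) (V W : normedModType R) k (U : set V)
  (f g : V -> W) : open U -> (forall x, U x -> f x = g x) ->
  Ck_on k U f -> Ck_on k U g.
Proof.
move=> oU; have nearU h h' x : (forall x, U x -> h x = h' x) -> U x ->
    \near x, h x = h' x :> W.
  by move=> hh' Ux; apply: filterS hh' _; exact: open_nbhs_nbhs.
have cfg h h' : (forall x, U x -> h x = h' x) ->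
    (forall x, U x -> {for x, continuous h}) ->
    forall x, U x -> {for x, continuous (h' : V -> W)}.
  move=> hh' ch x Ux; rewrite /prop_for /continuous_at -hh'//.
  by apply: cvg_trans (ch _ Ux); apply: near_eq_cvg; exact: nearU.
elim: k f g => [|k IH] f g fg [cf df]; (split=> //; first exact: cfg cf).
move=> v; have [dfv Cdf] := df v; split=> [x Ux|].
  exact: near_eq_derivable (nearU _ _ _ fg Ux) (dfv _ Ux).
by apply: IH Cdf => x Ux; apply: near_eq_derive; exact: nearU.
Qed.

Lemma Ck_on_derive (R : realType) (V W : normedModType R) k (U : set V)
  (f : V -> W) v : Ck_on k.+1 U f -> Ck_on k U ('D_v f).
Proof. by move=> [_ /(_ v)[]]. Qed.

Lemma Ck_on_derivable (R : realType) (V W : normedModType R) k (U : set V)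
  (f : V -> W) v x : Ck_on k.+1 U f -> U x -> derivable f x v.
Proof. by move=> [_ /(_ v)[+ _]]; apply. Qed.

Lemma Ck_on_cst (R : realType) (V W : normedModType R) k (U : set V) (a : W) :
  Ck_on k U (cst a : V -> W).
Proof.
elim: k a => [|k IH] a; (split=> //; first by move=> x _; exact: cst_continuous).
move=> v; split=> [x _|]; first exact: derivable_cst.
suff -> : 'D_v (cst a : V -> W) = cst 0 by [].
by apply/funext => x; exact: derive_cst.
Qed.

Lemma Ck_onD (R : realType) (V W : normedModType R) k (U : set V)
  (f g : V -> W) : open U -> Ck_on k U f -> Ck_on k U g ->
  Ck_on k U (fun x => f x + g x).
Proof.
move=> oU; elim: k f g => [|k IH] f g Cf Cg;
  (split=> //; first by move=> x Ux; apply: continuousD;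
    [exact: Ck_on_continuous Cf _ Ux|exact: Ck_on_continuous Cg _ Ux]).
move=> v; split=> [x Ux|].
  by apply: derivableD; [exact: Ck_on_derivable Cf Ux|exact: Ck_on_derivable Cg Ux].
apply: (@Ck_on_eq _ _ _ _ _ (fun x => 'D_v f x + 'D_v g x)) => // [x Ux|].
  by rewrite -deriveD//; [exact: Ck_on_derivable Cf Ux|exact: Ck_on_derivable Cg Ux].
by apply: IH; exact: Ck_on_derive.
Qed.

Lemma Ck_onM (R : realType) (V : normedModType R) k (U : set V)
  (f g : V -> R) : open U -> Ck_on k U f -> Ck_on k U g ->
  Ck_on k U (fun x => f x * g x).
Proof.
move=> oU; elim: k f g => [|k IH] f g Cf Cg;
  (split=> //; first by move=> x Ux; apply: continuousM;
    [exact: Ck_on_continuous Cf _ Ux|exact: Ck_on_continuous Cg _ Ux]).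
move=> v; split=> [x Ux|].
  by apply: derivableM; [exact: Ck_on_derivable Cf Ux|exact: Ck_on_derivable Cg Ux].
apply: (@Ck_on_eq _ _ _ _ _ (fun x => f x * 'D_v g x + g x * 'D_v f x)) => // [x Ux|].
  by rewrite -[RHS]/('D_v (f * g) x) deriveM//;
    [exact: Ck_on_derivable Cf Ux|exact: Ck_on_derivable Cg Ux].
by apply: Ck_onD => //; apply: IH => //; first [exact: Ck_onS|exact: Ck_on_derive].
Qed.

Lemma Ck_onN (R : realType) (V : normedModType R) k (U : set V) (f : V -> R) :
  open U -> Ck_on k U f -> Ck_on k U (fun x => - f x).
Proof.
move=> oU Cf; rewrite (_ : (fun x => - f x) = (fun x => cst (-1) x * f x)).
  by apply: Ck_onM => //; exact: Ck_on_cst.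
by apply/funext => x; rewrite mulN1r.
Qed.

Lemma Ck_onV (R : realType) (V : normedModType R) k (U : set V) (f : V -> R) :
  open U -> (forall x, U x -> f x != 0) -> Ck_on k U f ->
  Ck_on k U (fun x => (f x)^-1).
Proof.
move=> oU f0; elim: k => [|k IH] Cf;
  (split=> //; first by move=> x Ux; apply: continuousV;
    [exact: f0|exact: Ck_on_continuous Cf _ Ux]).
move=> v; split=> [x Ux|].
  by apply: derivableV; [exact: f0|exact: Ck_on_derivable Cf Ux].
apply: (@Ck_on_eq _ _ _ _ _ (fun x => - ((f x)^-1 * (f x)^-1 * 'D_v f x))) => // [x Ux|].
  by rewrite deriveV ?f0//; [rewrite -invfM -expr2 scaleNr|exact: Ck_on_derivable Cf Ux].
have Cfk : Ck_on k U f by exact: Ck_onS.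
by apply: Ck_onN => //; do 2?[apply: Ck_onM => //]; [exact: IH|exact: IH|exact: Ck_on_derive].
Qed.

Lemma cvg_mx (R : realType) (T : Type) (F : set_system T) m n
  (A : T -> 'M[R]_(m, n)) (a : 'M[R]_(m, n)) : Filter F ->
  (forall i j, A t i j @[t --> F] --> a i j) -> A t @[t --> F] --> a.
Proof.
move=> FF cA; apply/cvgrPdist_lt => e e0; near=> y.
rewrite [ltLHS]/Num.norm/= mx_normrE.
apply/bigmax_ltP; split=> // -[i j] _ /=; rewrite !mxE.
move: i j; near: y; apply: filter_forall => i; apply: filter_forall => j.
by have /cvgrPdist_lt/(_ e e0) := cA i j.
Unshelve. all: by end_near. Qed.

(** The derivative of a matrix is the matrix of the derivatives, so being of
    class C^k is a condition on the entries; [Ck_on_coord] is the converse. *)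
Lemma Ck_on_mx (R : realType) (V : normedModType R) k (U : set V) m n
  (f : V -> 'M[R]_(m, n)) : open U ->
  (forall i j, Ck_on k U (fun x => f x i j : R)) -> Ck_on k U f.
Proof.
move=> oU; elim: k f => [|k IH] f Cf; (split=> //; first by move=> x Ux;
  apply: cvg_mx => i j; exact: Ck_on_continuous (Cf i j) _ Ux).
have df v x : U x -> derivable f x v.
  by move=> Ux; apply/derivable_mxP => i j; exact: Ck_on_derivable (Cf i j) Ux.
move=> v; split=> [x Ux|]; first exact: df.
apply: IH => i j; apply: (@Ck_on_eq _ _ _ _ _ ('D_v (fun x => f x i j : R))) => //.
  by move=> x Ux; rewrite derive_mx ?mxE//; exact: df.
exact: Ck_on_derive.
Qed.

Lemma Ck_on_coord (R : realType) (V : normedModType R) k (U : set V) m n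
  (f : V -> 'M[R]_(m, n)) i j : open U ->
  Ck_on k U f -> Ck_on k U (fun x => f x i j : R).
Proof.
move=> oU; elim: k f => [|k IH] f Cf; split=> //;
  try by (move=> x Ux; apply: (@continuous_comp _ _ _ f (fun A : 'M[R]_(m, n) => A i j));
    [exact: Ck_on_continuous Cf _ Ux|exact: coord_continuous]).
move=> v; split=> [x Ux|].
  by have /derivable_mxP := Ck_on_derivable (v := v) Cf Ux; apply.
apply: (@Ck_on_eq _ _ _ _ _ (fun x => 'D_v f x i j)) => // [x Ux|].
  by rewrite derive_mx ?mxE//; exact: Ck_on_derivable Cf Ux.
by apply: IH; exact: Ck_on_derive.
Qed.

(** * Mean value theorem along lines *)

Lemma derive_line (R : realType) (V : normedModType R) (f : V -> R) x v (s : R) :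
  derivable f (x + s *: v) v ->
  is_derive s 1 (fun r : R => f (x + r *: v)) ('D_v f (x + s *: v)).
Proof.
have E : (fun h : R => h^-1 *: (f (h *: v + (x + s *: v)) - f (x + s *: v))) =
  (fun h : R => h^-1 *: (f (x + (h *: (1:R) + s) *: v) - f (x + s *: v))).
  by apply/funext => h; rewrite [h *: 1]mulr1 scalerDl addrCA.
by rewrite /derivable /= E => df; split; [exact: df|rewrite /derive /= E].
Qed.

Lemma mean_value_line (R : realType) (V : normedModType R) (f : V -> R) x v :
  (forall s : R, 0 <= s <= 1 -> derivable f (x + s *: v) v) ->
  exists2 s : R, 0 <= s <= 1 & f (x + v) - f x = 'D_v f (x + s *: v).
Proof.
move=> df; have d (s : R) : s \in `[0, 1]%R -> is_derive s 1
    (fun r : R => f (x + r *: v)) ('D_v f (x + s *: v)).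
  by move=> s01; apply: derive_line; apply: df; move: s01; rewrite in_itv.
have [|s s01] := @MVT_segment R _ _ 0 1 ler01 (fun s hs => d s (subset_itv_oo_cc hs)).
  by apply: derivable_within_continuous => s s01; have [] := d s s01.
rewrite scale1r scale0r addr0 subr0 mulr1 => ->; by exists s.
Qed.

Lemma deriveZv (R : realType) (V W : normedModType R) (f : V -> W) x v (k : R) :
  derivable f x v -> is_derive x (k *: v) f (k *: 'D_v f x).
Proof.
move=> /derivable1P/derivable1_diffP; set g := (fun h : R => _) => dg.
have E : (fun h : R => h^-1 *: (f (h *: (k *: v) + x) - f x)) =
  (fun h : R => h^-1 *: (g (h *: k + 0) - g 0)).
  by apply/funext => h; rewrite /g scale0r add0r addr0 scalerA.
have E1 : (fun h : R => h^-1 *: (f (h *: v + x) - f x)) =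
  (fun h : R => h^-1 *: (g (h *: (1 : R) + 0) - g 0)).
  by apply/funext => h; rewrite /g scale0r add0r addr0 [h *: 1]mulr1.
split; first by rewrite /derivable /= E; exact: (diff_derivable (v := k) dg).
rewrite /derive /= E E1 -[lim _]/('D_k g 0) -[X in _ = k *: X]/('D_1 g 0).
by rewrite !deriveE// -linearZ/= [k *: 1]mulr1.
Qed.

(** The mixed second difference of [f] on a parallelogram is, by two applications
    of the mean value theorem, a value of ['D_v ('D_u f)] near [x]. *)
Lemma second_difference (R : realType) (V : normedModType R) (f : V -> R)
    (U : set V) u v x :
  (forall s r : R, 0 <= s <= 1 -> 0 <= r <= 1 -> U (x + s *: u + r *: v)) ->
  (forall y w, U y -> derivable f y w) ->
  (forall y, U y -> derivable ('D_u f) y v) ->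
  exists s r : R, [/\ 0 <= s <= 1, 0 <= r <= 1 &
    f (x + u + v) - f (x + u) - (f (x + v) - f x)
    = 'D_v ('D_u f) (x + s *: u + r *: v)].
Proof.
move=> Ux df ddf.
have U0 (s : R) : 0 <= s <= 1 -> U (x + s *: u).
  by move=> /(Ux s 0); rewrite scale0r addr0 lexx ler01; apply.
have U1 (s : R) : 0 <= s <= 1 -> U (x + s *: u + v).
  by move=> /(Ux s 1); rewrite scale1r lexx ler01; apply.
have dg (y : V) : U y -> U (y + v) ->
    is_derive y u (fun z => f (z + v) - f z : R) ('D_u f (y + v) - 'D_u f y).
  move=> Uy Uyv; apply: is_deriveB; last exact/derivableP/df.
  have E : (fun h : R => h^-1 *: (f (h *: u + y + v) - f (y + v))) =
    (fun h : R => h^-1 *: (f (h *: u + (y + v)) - f (y + v))).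
    by apply/funext => h; rewrite addrA.
  have := df _ u Uyv; rewrite /derivable /= -E => d.
  by split => //; rewrite /derive /= E.
have [s s01] : exists2 s : R, 0 <= s <= 1 &
    f (x + u + v) - f (x + u) - (f (x + v) - f x) =
    'D_u (fun z => f (z + v) - f z : R) (x + s *: u).
  apply: (mean_value_line (f := fun z => f (z + v) - f z)) => s s01.
  by have [] := dg _ (U0 _ s01) (U1 _ s01).
have [_ ->] := dg _ (U0 _ s01) (U1 _ s01).
have [r r01 ->] := mean_value_line (fun r r01 => ddf _ (Ux s r s01 r01)).
by move=> ->; exists s, r.
Qed.

(** * Symmetry of second derivatives; functions of class C^1 are differentiable *)

(** The second difference is symmetric in [u] and [v]; on parallelograms shrinking
    to [x] its two expressions converge to the two mixed derivatives. *)
Lemma schwarz (R : realType) (V : normedModType R) (f : V -> R) (U : set V) u v x :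
  open U -> Ck_on 2 U f -> U x -> 'D_v ('D_u f) x = 'D_u ('D_v f) x.
Proof.
move=> oU Cf Ux.
have ddf w y (w' : V) : U y -> derivable ('D_w f) y w'.
  by move=> Uy; exact: Ck_on_derivable (Ck_on_derive w Cf) Uy.
have df y w : U y -> derivable f y w.
  by move=> Uy; exact: Ck_on_derivable Cf Uy.
have scale (h : R) w w' y : U y ->
    'D_(h *: w) ('D_(h *: w') f) y = h * (h * 'D_w ('D_w' f) y).
  move=> Uy; have [_ ->] := deriveZv h (ddf (h *: w') _ w Uy).
  congr (_ * _); transitivity ('D_w (fun z => h *: 'D_w' f z) y).
    apply: near_eq_derive; apply: (filterS _ (open_nbhs_nbhs (conj oU Uy))) => z Uz.
    by have [_ ->] := deriveZv h (df _ w' Uz).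
  exact: deriveZ (ddf _ _ _ Uy).
have cont w w' : {for x, continuous ('D_w ('D_w' f))}.
  exact: Ck_on_continuous (Ck_on_derive w (Ck_on_derive w' Cf)) _ Ux.
apply/eqP; rewrite -subr_eq0 -normr_le0; apply/ler_addgt0Pl => e e0; rewrite addr0.
have e20 : 0 < e / 2 by rewrite divr_gt0.
have : \forall y \near x, [/\ U y, `|'D_v ('D_u f) x - 'D_v ('D_u f) y| < e / 2
    & `|'D_u ('D_v f) x - 'D_u ('D_v f) y| < e / 2].
  have /cvgrPdist_lt/(_ _ e20) H1 := cont v u.
  have /cvgrPdist_lt/(_ _ e20) H2 := cont u v.
  have HU : \forall y \near x, U y := open_nbhs_nbhs (conj oU Ux).
  apply: filterS3 HU H1 H2 => y; exact: And3.
move=> /nbhs_normP[d /= d0 dP].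
pose K := `|u| + `|v| + 1; have K0 : 0 < K by rewrite ltr_wpDl// addr_ge0.
have [h h0 hK] : exists2 h, 0 < h & h * K < d.
  exists (d / (2 * K)); first by rewrite divr_gt0// mulr_gt0.
  have -> : d / (2 * K) * K = d / 2 by field; rewrite gt_eqF.
  lra.
have small (s r : R) : 0 <= s <= 1 -> 0 <= r <= 1 ->
    `|s *: (h *: u) + r *: (h *: v)| < d.
  move=> /andP[s0 s1] /andP[r0 r1].
  apply: le_lt_trans hK.
  apply: le_trans (ler_normD _ _) _.
  rewrite !normrZ (ger0_norm s0) (ger0_norm r0) (gtr0_norm h0) /K.
  have nu := normr_ge0 u; have nv := normr_ge0 v.
  have : s * (h * `|u|) <= h * `|u| by rewrite ler_piMl// mulr_ge0// ltW.
  have : r * (h * `|v|) <= h * `|v| by rewrite ler_piMl// mulr_ge0// ltW.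
  by rewrite !mulrDr mulr1; lra.
have P (s r : R) : 0 <= s <= 1 -> 0 <= r <= 1 ->
  [/\ U (x + s *: (h *: u) + r *: (h *: v)),
   `|'D_v ('D_u f) x - 'D_v ('D_u f) (x + s *: (h *: u) + r *: (h *: v))| < e / 2
    & `|'D_u ('D_v f) x - 'D_u ('D_v f) (x + s *: (h *: u) + r *: (h *: v))| < e / 2].
  move=> s01 r01; apply: dP => /=; rewrite -addrA.
  by rewrite /ball_ /= opprD addNKr normrN; exact: small.
have [s [r [s01 r01 E1]]] := @second_difference _ _ f U (h *: u) (h *: v) x
  (fun s r s01 r01 => let: And3 A _ _ := P s r s01 r01 in A) df
  (fun y => ddf _ y _).
have [s' [r' [s'01 r'01 E2]]] := @second_difference _ _ f U (h *: v) (h *: u) x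
  (fun s r s01 r01 => let: And3 A _ _ := P r s r01 s01 in
     eq_ind _ U A _ (addrAC _ _ _)) df
  (fun y => ddf _ y _).
have [Usr Psr _] := P _ _ s01 r01; have [Usr' _ Psr'] := P _ _ r'01 s'01.
rewrite addrAC in Usr' Psr'.
rewrite scale// in E1; rewrite scale// in E2.
have E : 'D_v ('D_u f) (x + s *: (h *: u) + r *: (h *: v)) =
         'D_u ('D_v f) (x + s' *: (h *: v) + r' *: (h *: u)).
  apply: (mulfI (lt0r_neq0 h0)); apply: (mulfI (lt0r_neq0 h0)).
  have swap (a b c b' : R) : a - b - (b' - c) = a - b' - (b - c) by ring.
  apply: etrans (esym E1) _; apply: etrans _ E2.
  by rewrite swap (addrAC x).
rewrite E in Psr.
rewrite (splitr e); rewrite distrC in Psr'.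
exact: le_trans (ler_distD _ _ _) (lerD (ltW Psr) (ltW Psr')).
Qed.

(** The definition of the differential, with the little-o made explicit. *)
Lemma differentiable_linear_approx (R : realType) (V W : normedModType R)
    (f : V -> W) (L : {linear V -> W}) x : continuous L ->
  (forall e : R, 0 < e -> \forall h \near 0, `|f (x + h) - f x - L h| <= e * `|h|) ->
  differentiable f x.
Proof.
move=> cL approx.
have E : f \o shift x = cst (f x) + L +o_ 0 id.
  apply/eqaddoP => e e0; apply: filterS (approx e e0) => h.
  by rewrite -addrA -opprD addrC [x + h]addrC addrC.
by apply/diff_locallyP; rewrite (diff_unique cL E).
Qed.

(** The increment is split into steps along the coordinate axes; on each step the
    mean value theorem turns it into a partial derivative at a nearby point, and
    the partial derivatives are continuous. *)
Lemma C1_differentiable_real (R : realType) d (f : 'rV[R]_d -> R)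
    (U : set 'rV[R]_d) x :
  open U -> Ck_on 1 U f -> U x -> differentiable f x.
Proof.
move=> oU Cf Ux.
pose e i : 'rV[R]_d := delta_mx 0 i.
pose g i := 'D_(e i) f x.
pose l (h : 'rV[R]_d) : R := \sum_i h 0 i * g i.
have l_lin : linear l.
  move=> a u v; rewrite /l scaler_sumr -big_split; apply: eq_bigr => i _ /=.
  by rewrite !mxE mulrDl -mulrA.
pose lM := GRing.isLinear.Build _ _ _ _ _ l_lin.
pose L : {linear 'rV[R]_d -> R} := HB.pack l lM.
have cL : continuous L.
  move=> y; apply: differentiable_continuous.
  rewrite (_ : (L : _ -> _) = \sum_i (fun h : 'rV[R]_d => h 0 i * g i)).
    apply: differentiable_sum => i; apply: differentiableM => //.
    exact: differentiable_coord.
  by apply/funext => h; rewrite fct_sumE.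
apply: (differentiable_linear_approx cL) => _/posnumP[eps].
have d0 : 0 < eps%:num / d.+1%:R by rewrite divr_gt0.
have near_g : \forall y \near x, U y /\
    forall i, `|g i - 'D_(e i) f y| < eps%:num / d.+1%:R.
  have HU : \forall y \near x, U y := open_nbhs_nbhs (conj oU Ux).
  have HD : \forall y \near x, forall i, `|g i - 'D_(e i) f y| < eps%:num / d.+1%:R.
    apply: (@filter_forall _ _ (fun i y => `|g i - 'D_(e i) f y| < _) (nbhs x) _) => i.
    have /cvgrPdist_lt/(_ _ d0) := Ck_on_continuous (Ck_on_derive (e i) Cf) Ux.
    exact.
  by apply: filterS2 HU HD => y Uy Dy; split.
have /nbhs_normP[r /= r0 Pr] := near_g.
apply/nbhs_normP; exists r => //= h; rewrite /ball_/= sub0r normrN => hr.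
pose t k : 'rV[R]_d := \row_i (if (i < k)%N then h 0 i else 0).
(* moving one coordinate at a time stays in the ball, the norm being the sup norm *)
have step (k : 'I_d) : `|f (x + t k.+1) - f (x + t k) - h 0 k * g k|
    <= eps%:num / d.+1%:R * `|h|.
  have tS : t k.+1 = t k + h 0 k *: e k.
    apply/rowP => i; rewrite !mxE ltnS leq_eqVlt eqxx/=.
    have [->|ik] := eqVneq i k; first by rewrite eqxx ltnn mulr1 add0r.
    by rewrite mulr0 addr0; move: ik; rewrite -(inj_eq val_inj)/= => /negPf ->.
  have hk i : `|h 0 i| <= `|h|.
    by rewrite [leRHS]/Num.norm/= mx_normrE;
      apply: (le_bigmax _ (fun ij => `|h ij.1 ij.2|) (0, i)).
  have tn (s : R) : 0 <= s <= 1 -> `|t k + s *: (h 0 k *: e k)| < r.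
    move=> /andP[s0 s1]; apply: le_lt_trans hr.
    rewrite [leLHS]/Num.norm/= mx_normrE; apply: bigmax_le => // -[a i] _ /=.
    rewrite !mxE (ord1 a) eqxx/=; have [->|ik] := eqVneq i k.
      rewrite ltnn add0r mulr1 normrM (ger0_norm s0).
      by apply: le_trans (hk k); rewrite ler_piMl.
    by rewrite !mulr0 addr0; case: ifP => // _; rewrite normr0.
  have dP (s : R) : 0 <= s <= 1 -> U (x + t k + s *: (h 0 k *: e k)) /\
      `|g k - 'D_(e k) f (x + t k + s *: (h 0 k *: e k))| < eps%:num / d.+1%:R.
    move=> s01; have [|Uy Dy] := Pr (x + t k + s *: (h 0 k *: e k)); last by split.
    by rewrite /ball_/= -addrA opprD addNKr normrN; exact: tn.
  have [s s01] := mean_value_line (fun s s01 =>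
    Ck_on_derivable (v := h 0 k *: e k) Cf (dP s s01).1).
  have [Uy Dy] := dP s s01.
  have [_ ->] := deriveZv (h 0 k) (Ck_on_derivable (v := e k) Cf Uy).
  rewrite tS addrA => ->; rewrite -mulrBr normrM mulrC distrC.
  by apply: ler_pM => //; exact: ltW.
have -> : f (x + h) - f x - L h =
    \sum_(k < d) (f (x + t k.+1) - f (x + t k) - h 0 k * g k).
  rewrite sumrB /= -(big_mkord xpredT (fun k => f (x + t k.+1) - f (x + t k))).
  rewrite (telescope_sumr (fun k => f (x + t k)))//.
  have -> : t d = h by apply/rowP => i; rewrite mxE ltn_ord.
  have -> : t 0 = 0 by apply/rowP => i; rewrite !mxE.
  by rewrite addr0.
apply: le_trans (ler_norm_sum _ _ _) _.
apply: le_trans (ler_sum _ (fun k _ => step k)) _.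
rewrite sumr_const card_ord -mulrnAl ler_wpM2r//.
by rewrite -(mulr_natl _ d) mulrCA ler_piMr// ler_pdivrMr// mul1r ler_nat.
Qed.

(** * Charts and frames *)

Lemma C1_differentiable (R : realType) d m (f : 'rV[R]_d -> 'rV[R]_m)
    (U : set 'rV[R]_d) x :
  open U -> Ck_on 1 U f -> U x -> differentiable f x.
Proof.
move=> oU Cf Ux.
have -> : f = \sum_k (fun y => f y 0 k *: (delta_mx 0 k : 'rV[R]_m)).
  by apply/funext => y; rewrite fct_sumE; exact: row_sum_delta.
apply: differentiable_sum => k; apply: differentiableZl.
exact: C1_differentiable_real oU (Ck_on_coord 0 k oU Cf) Ux.
Qed.

Lemma atlas_smooth (R : realType) d (M : manifold R d) (c : chart R d M) :
  atlas c -> smooth_chart c.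
Proof. by move=> ac c' ac'; exact: atlas_compatible. Qed.

Lemma paramK (R : realType) d (T : topologicalType) (c : chart R d T) x :
  chart_image c x -> dom c (param c x) /\ coords c (param c x) = x.
Proof. by move=> [p dp <-]; rewrite coordK. Qed.

Lemma open_coords (R : realType) d (T : topologicalType) (c : chart R d T)
    (U : set T) : open U -> open (coords c @` (dom c `&` U)).
Proof.
move=> oU; rewrite openE => _ [p [dp Up] <-].
have ip : chart_image c (coords c p) by exists p.
have nI : \forall x \near coords c p, chart_image c x.
  by apply: open_nbhs_nbhs; split=> //; exact: open_chart_image.
have nU : \forall x \near coords c p, U (param c x).
  apply: (continuous_param ip); rewrite coordK//.
  exact: open_nbhs_nbhs (conj oU Up).
rewrite /interior; apply: filterS2 nI nU => x /paramK[dx cx] Ux.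
by exists (param c x).
Qed.

Lemma near_param (R : realType) d (T : topologicalType) (c : chart R d T)
    (U : set T) p : open U -> dom c p -> U p ->
  \forall x \near coords c p,
    [/\ dom c (param c x), U (param c x) & coords c (param c x) = x].
Proof.
move=> oU dp Up; have : (coords c @` (dom c `&` U)) (coords c p) by exists p.
move=> /(conj (open_coords (c := c) oU))/open_nbhs_nbhs; apply: filterS => _ [q [dq Uq] <-].
by rewrite coordK.
Qed.

Lemma transition_differentiable (R : realType) d (M : manifold R d)
    (c c' : chart R d M) p :
  smooth_compatible c c' -> dom c p -> dom c' p ->
  differentiable (transition c c') (coords c p).
Proof.
move=> [cc' _] dp d'p; apply: C1_differentiable (cc' 1%N) _.
  exact/open_coords/open_dom.
by exists p.
Qed.

(** Chain rule: the frame of [c] at [p] carries components in [c] to components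
    in the preferred chart, so differentials may be computed in [c]. *)
Lemma dfun_frame (R : realType) d (M : manifold R d) (c : chart R d M)
    (U : set M) (f : M -> R) p v :
  smooth_chart c -> open U -> smooth_fun U f -> dom c p -> U p ->
  dfun f p (v *m frame c p) = 'D_v (fun x => f (param c x) : R) (coords c p).
Proof.
move=> sc oU sf dp Up; set c' := chart_at p.
have ac' : atlas c' := chart_at_atlas p; have d'p : dom c' p := chart_at_dom p.
pose g x : R := f (param c' x); pose phi := transition c c'.
have phip : phi (coords c p) = coords c' p by rewrite /phi/transition/= coordK.
have dphi : differentiable phi (coords c p).
  exact: transition_differentiable (sc _ ac') dp d'p.
have dg : differentiable g (phi (coords c p)).
  rewrite phip; apply: C1_differentiable_real (sf _ (atlas_smooth ac') 1%N) _.
    exact: open_coords.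
  by exists p.
have -> : 'D_v (fun x => f (param c x) : R) (coords c p) =
    'D_v (g \o phi) (coords c p).
  apply: near_eq_derive; apply: filterS (near_param (open_dom c') dp d'p) => x.
  by move=> [dx d'x _]; rewrite /g /phi/transition/= coordK.
rewrite deriveE; last exact: differentiable_comp.
rewrite diff_comp//= /dfun -/c' -phip deriveE//.
by rewrite -(deriveE v dphi) (deriveEjacobian v dphi).
Qed.

(** The Jacobian of the opposite transition map is an inverse. *)
Lemma frame_unit (R : realType) d (M : manifold R d) (c : chart R d M) p :
  smooth_chart c -> dom c p -> frame c p \in unitmx.
Proof.
move=> sc dp; rewrite /frame; set c' := chart_at p.
have ac' : atlas c' := chart_at_atlas p; have d'p : dom c' p := chart_at_dom p.
pose phi := transition c c'; pose psi := transition c' c.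
have phip : phi (coords c p) = coords c' p by rewrite /phi/transition/= coordK.
have dphi : differentiable phi (coords c p).
  exact: transition_differentiable (sc _ ac') dp d'p.
have dpsi : differentiable psi (phi (coords c p)).
  rewrite phip; apply: transition_differentiable => //.
  by have [? ?] := sc _ ac'; rewrite /smooth_compatible setIC; split.
suff E : jacobian phi (coords c p) *m jacobian psi (phi (coords c p)) = 1%:M.
  exact: (mulmx1_unit E).1.
apply/row_matrixP => i; rewrite !rowE mulmxA mulmx1.
rewrite -!deriveEjacobian// deriveE// deriveE//.
have := diff_comp dphi dpsi => /(congr1 (fun h => h (delta_mx 0 i))) /= <-.
rewrite -deriveE; last exact: differentiable_comp.
rewrite -[RHS](derive_id (coords c p)); apply: near_eq_derive.
apply: filterS (near_param (open_dom c') dp d'p) => x [dx d'x cx].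
by rewrite /psi /phi /transition /= coordK.
Qed.

(** * The Hermitian product and the Fubini-Study form *)

Lemma conjcM (R : realType) (x y : R[i]) : (x * y)^*%C = x^*%C * y^*%C.
Proof. exact: (rmorphM (@conjc R)). Qed.

Lemma conjcB (R : realType) (x y : R[i]) : (x - y)^*%C = x^*%C - y^*%C.
Proof. exact: (rmorphB (@conjc R)). Qed.

Lemma hdotDl (R : realType) N (a b c : 'rV[R[i]]_N.+1) :
  hdot (a + b) c = hdot a c + hdot b c.
Proof.
by rewrite /hdot -big_split; apply: eq_bigr => k _; rewrite mxE mulrDl.
Qed.

Lemma hdotZl (R : realType) N (s : R[i]) (a b : 'rV[R[i]]_N.+1) :
  hdot (s *: a) b = s * hdot a b.
Proof.
by rewrite /hdot mulr_sumr; apply: eq_bigr => k _; rewrite mxE mulrA.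
Qed.

Lemma hdotC (R : realType) N (a b : 'rV[R[i]]_N.+1) :
  hdot b a = (hdot a b)^*%C.
Proof.
rewrite /hdot raddf_sum; apply: eq_bigr => k _.
by rewrite /= conjcM conjcK mulrC.
Qed.

Lemma hdotZr (R : realType) N (s : R[i]) (a b : 'rV[R[i]]_N.+1) :
  hdot a (s *: b) = s^*%C * hdot a b.
Proof. by rewrite hdotC hdotZl conjcM -hdotC. Qed.

Lemma hdotBl (R : realType) N (a b c : 'rV[R[i]]_N.+1) :
  hdot (a - b) c = hdot a c - hdot b c.
Proof. by rewrite -scaleN1r hdotDl hdotZl mulN1r. Qed.

Lemma hdotBr (R : realType) N (a b c : 'rV[R[i]]_N.+1) :
  hdot a (b - c) = hdot a b - hdot a c.
Proof. by rewrite hdotC hdotBl conjcB -!hdotC. Qed.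

Lemma hdot_ge0 (R : realType) N (a : 'rV[R[i]]_N.+1) : 0 <= hdot a a.
Proof. by apply: sumr_ge0 => k _; exact: mulcJ_ge0. Qed.

Lemma hdot_eq0 (R : realType) N (a : 'rV[R[i]]_N.+1) : hdot a a = 0 -> a = 0.
Proof.
move=> a0; apply/rowP => k; rewrite mxE.
have : a 0 k * (a 0 k)^*%C = 0.
  by apply: (psumr_eq0P _ a0) => // j _; exact: mulcJ_ge0.
by move=> /eqP; rewrite mulf_eq0 conjc_eq0 orbb => /eqP.
Qed.

Lemma fubini_study_mulI (R : realType) N (u a b : 'rV[R[i]]_N.+1) :
  fubini_study u ('i%C *: a) ('i%C *: b) = fubini_study u a b.
Proof.
rewrite /fubini_study !hdotZl !hdotZr; congr (- complex.Im (_ / _)).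
have ii : 'i%C * ('i%C)^*%C = 1 :> R[i] by simpc.
by rewrite [X in _ - X]mulrACA ii mul1r mulrA ii mul1r.
Qed.

Lemma fubini_studyC (R : realType) N (u a b : 'rV[R[i]]_N.+1) :
  fubini_study u b a = - fubini_study u a b.
Proof.
rewrite /fubini_study; set z := (X in complex.Im X).
have -> : (hdot a b * hdot u u - hdot a u * hdot u b) / hdot u u ^+ 2 = z^*%C.
  rewrite /z conjcM conjc_inv expr2 conjcB !conjcM -!hdotC -expr2.
  by rewrite (mulrC (hdot u b)).
by case: z => x y /=; rewrite opprK.
Qed.

(** The Cauchy-Schwarz inequality, read off from the square norm of
    [h(u, u) a - h(a, u) u]. *)
Lemma fubini_study_ge0 (R : realType) N (u a : 'rV[R[i]]_N.+1) :
  0 <= fubini_study u a ('i%C *: a).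
Proof.
have [->|u0] := eqVneq u 0.
  have h0 b : hdot (0 : 'rV[R[i]]_N.+1) b = 0.
    by rewrite -(scale0r (0 : 'rV__)) hdotZl mul0r.
  by rewrite /fubini_study !h0 expr0n/= invr0 mulr0 oppr0.
have N0 : 0 < hdot u u.
  by rewrite lt0r hdot_ge0 andbT; apply: contra_neq u0; exact: hdot_eq0.
set H := hdot a a * hdot u u - hdot a u * hdot u a.
have H0 : 0 <= H.
  have := hdot_ge0 (hdot u u *: a - hdot a u *: u).
  have -> : hdot (hdot u u *: a - hdot a u *: u) (hdot u u *: a - hdot a u *: u)
     = hdot u u * H.
    rewrite !(hdotBl, hdotBr) !(hdotZl, hdotZr) -!hdotC /H; ring.
  by rewrite pmulr_rge0.
have : 0 <= H / hdot u u ^+ 2 by rewrite divr_ge0// exprn_ge0// ltW.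
rewrite /fubini_study !hdotZr.
have -> : ('i%C)^*%C * hdot a a * hdot u u - hdot a u * (('i%C)^*%C * hdot u a)
  = ('i%C)^*%C * H by rewrite /H; ring.
rewrite -mulrA; case: (H / _) => x y; rewrite lecE /= => /andP[_].
by rewrite !mul0r !mulN1r sub0r ?opprK ?oppr0 ?addr0 ?add0r ?opprK.
Qed.

(** * A primitive of the pullback of the Fubini-Study form *)

Definition complex_row (R : realType) N (x y : 'I_N -> R) : 'rV[R[i]]_N :=
  \row_k Complex (x k) (y k).

Lemma hdot_complex_row (R : realType) N (x y a b : 'I_N.+1 -> R) :
  hdot (complex_row x y) (complex_row a b) =
  Complex (\sum_k (x k * a k + y k * b k)) (\sum_k (y k * a k - x k * b k)).
Proof.
have -> (f g : 'I_N.+1 -> R) : Complex (\sum_k f k) (\sum_k g k) =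
    \sum_k Complex (f k) (g k).
  by elim/big_rec3: _ => // k f' g' z _ <-; simpc.
apply: eq_bigr => k _; rewrite !mxE; simpc.
by congr Complex; rewrite addrC.
Qed.

(** The Fubini-Study form in real coordinates, with [r] and [s] the real and
    imaginary parts of the Hermitian product. *)
Lemma fubini_study_complex_row (R : realType) N (x y a a' b b' : 'I_N.+1 -> R) :
  let n := \sum_k (x k * x k + y k * y k) in
  let r (p p' q q' : 'I_N.+1 -> R) := \sum_k (p k * q k + p' k * q' k) in
  let s (p p' q q' : 'I_N.+1 -> R) := \sum_k (p' k * q k - p k * q' k) in
  fubini_study (complex_row x y) (complex_row a a') (complex_row b b') =
  - ((s a a' b b' * n - (r a a' x y * s x y b b' + s a a' x y * r x y b b'))
     / n ^+ 2).
Proof.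
move=> n r s; rewrite /fubini_study !hdot_complex_row -/(r _ _ _ _) -/n.
have -> : \sum_k (y k * x k - x k * y k) = 0.
  by apply: big1 => k _; rewrite mulrC subrr.
rewrite -/(s _ _ _ _).
have -> : Complex n 0 ^+ 2 = (n ^+ 2)%:C%C by rewrite expr2; simpc.
rewrite -fmorphV/=; congr (- _); simpc => /=.
by rewrite mulrC; congr (_ * _); rewrite /r /s; ring.
Qed.

Lemma smooth_on_derive (R : realType) (V W : normedModType R) (U : set V)
  (f : V -> W) v : smooth_on U f -> smooth_on U ('D_v f).
Proof. by move=> sf k; exact: Ck_on_derive (sf k.+1). Qed.

Lemma Ck_on_sum (R : realType) (V : normedModType R) k (U : set V) n
  (f : 'I_n -> V -> R) : open U -> (forall i, Ck_on k U (f i)) ->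
  Ck_on k U (fun x => \sum_i f i x).
Proof.
move=> oU Cf; elim: n f Cf => [|n IH] f Cf.
  apply: (@Ck_on_eq _ _ _ _ _ (cst 0)) => //; last exact: Ck_on_cst.
  by move=> x _; rewrite big_ord0.
apply: (@Ck_on_eq _ _ _ _ _ (fun x => f ord0 x + \sum_i f (lift ord0 i) x)) => //.
  by move=> x _; rewrite big_ord_recl.
by apply: Ck_onD => //; exact: IH.
Qed.

(** Half the imaginary part of [h(dF, F) / h(F, F)] for [F = X + i Y]: a
    primitive of the pullback of the Fubini-Study form by [F]. *)
Definition fubini_study_potential (R : realType) (V : normedModType R) N
    (X Y : 'I_N -> V -> R) (v : V) (x : V) : R :=
  2^-1 * (\sum_k ('D_v (Y k) x * X k x - 'D_v (X k) x * Y k x))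
  / \sum_k (X k x * X k x + Y k x * Y k x).

Lemma smooth_on_potential (R : realType) (V : normedModType R) N (U : set V)
    (X Y : 'I_N -> V -> R) v :
  open U -> (forall k, smooth_on U (X k)) -> (forall k, smooth_on U (Y k)) ->
  (forall x, U x -> \sum_k (X k x * X k x + Y k x * Y k x) != 0) ->
  smooth_on U (fubini_study_potential X Y v).
Proof.
move=> oU sX sY n0 k; rewrite /fubini_study_potential.
apply: Ck_onM => //.
  apply: (Ck_onM (f := cst 2^-1)) => //; first exact: Ck_on_cst.
  apply: Ck_on_sum => // i; apply: Ck_onD => //; last apply: Ck_onN => //.
    by apply: Ck_onM => //; [exact: smooth_on_derive|exact: sX].
  by apply: Ck_onM => //; [exact: smooth_on_derive|exact: sY].
apply: Ck_onV => //; apply: Ck_on_sum => // i.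
by apply: Ck_onD => //; apply: Ck_onM => //; first [exact: sX|exact: sY].
Qed.

Lemma is_derive_sum_fun (R : realType) (V W : normedModType R) n
    (h : 'I_n -> V -> W) x v (dh : 'I_n -> W) :
  (forall k, is_derive x v (h k) (dh k)) ->
  is_derive x v (fun y => \sum_k h k y) (\sum_k dh k).
Proof.
move=> d; have := is_derive_sum d; congr (is_derive _ _ _ _).
by apply/funext => y; rewrite fct_sumE.
Qed.

(** The second derivatives are left as parameters, so that the same values can be
    used for both orders of differentiation. *)
Lemma derive_potential (R : realType) (V : normedModType R) N (U : set V)
    (X Y : 'I_N -> V -> R) (Xvw Yvw : 'I_N -> R) v w x :
  (forall k, 'D_v ('D_w (X k)) x = Xvw k) ->
  (forall k, 'D_v ('D_w (Y k)) x = Yvw k) ->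
  open U -> (forall k, smooth_on U (X k)) -> (forall k, smooth_on U (Y k)) ->
  U x ->
  let n := \sum_k (X k x * X k x + Y k x * Y k x) in n != 0 ->
  'D_v (fubini_study_potential X Y w) x =
  2^-1 * ((\sum_k (Yvw k * X k x - Xvw k * Y k x)
           + \sum_k ('D_w (Y k) x * 'D_v (X k) x - 'D_w (X k) x * 'D_v (Y k) x)) * n
          - (\sum_k ('D_w (Y k) x * X k x - 'D_w (X k) x * Y k x))
            * (2 * \sum_k ('D_v (X k) x * X k x + 'D_v (Y k) x * Y k x))) / n ^+ 2.
Proof.
move=> XE YE oU sX sY Ux n n0.
have dX k : is_derive x v (X k) ('D_v (X k) x).
  by apply: derivableP; exact: Ck_on_derivable (sX k 1%N) Ux.
have dY k : is_derive x v (Y k) ('D_v (Y k) x).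
  by apply: derivableP; exact: Ck_on_derivable (sY k 1%N) Ux.
have ddX k : is_derive x v ('D_w (X k)) (Xvw k).
  by rewrite -XE; apply: derivableP; exact: Ck_on_derivable (smooth_on_derive w (sX k) 1%N) Ux.
have ddY k : is_derive x v ('D_w (Y k)) (Yvw k).
  by rewrite -YE; apply: derivableP; exact: Ck_on_derivable (smooth_on_derive w (sY k) 1%N) Ux.
have scE (a b : R) : a *: b = a * b by [].
set A := \sum_k (Yvw k * _ - _); set P := \sum_k (_ - _ * 'D_v (Y k) x).
set B := \sum_k (_ - _ * Y k x); set C := \sum_k (_ + 'D_v (Y k) x * _).
have dnum : is_derive x v (fun y => \sum_k ('D_w (Y k) * X k - 'D_w (X k) * Y k) y)
    (A + P).
  apply: is_derive_eq (is_derive_sum_fun (fun k =>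
    is_deriveB (is_deriveM (ddY k) (dX k)) (is_deriveM (ddX k) (dY k)))) _.
  rewrite /A /P -big_split; apply: eq_bigr => k _.
  by rewrite !scE /=; ring.
have dden : is_derive x v (fun y => \sum_k (X k * X k + Y k * Y k) y) (2 * C).
  apply: is_derive_eq (is_derive_sum_fun (fun k =>
    is_deriveD (is_deriveM (dX k) (dX k)) (is_deriveM (dY k) (dY k)))) _.
  rewrite /C mulr_sumr; apply: eq_bigr => k _.
  by rewrite !scE /=; ring.
have [dn dnE] := dden.
have dinv : is_derive x v (fun y => (\sum_k (X k * X k + Y k * Y k) y)^-1)
    (- n ^- 2 * (2 * C)).
  by split; [exact: derivableV|rewrite -dnE; exact: deriveV].
have dhalf := is_deriveM (is_derive_cst (2^-1 : R) x v) dnum.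
have [_ E] := is_deriveM dhalf dinv.
rewrite (_ : 'D_v _ x = (2^-1 * B) *: (- n ^- 2 * (2 * C))
  + n^-1 *: (2^-1 *: (A + P) + B *: 0)); last exact: E.
rewrite scaler0 addr0 !scE.
by clearbody A P B C n; field.
Qed.


(** The second derivatives drop out of the antisymmetrization in [v] and [w]. *)
Lemma fubini_study_curl (R : realType) N
    (x y xv yv xw yw xvw yvw : 'I_N.+1 -> R) :
  let n := \sum_k (x k * x k + y k * y k) in n != 0 ->
  let dpot xv yv xw yw := 2^-1 * ((\sum_k (yvw k * x k - xvw k * y k)
        + \sum_k (yw k * xv k - xw k * yv k)) * n
      - (\sum_k (yw k * x k - xw k * y k))
        * (2 * \sum_k (xv k * x k + yv k * y k))) / n ^+ 2 in
  dpot xv yv xw yw - dpot xw yw xv yv =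
  fubini_study (complex_row x y) (complex_row xv yv) (complex_row xw yw).
Proof.
move=> n n0 dpot; rewrite /dpot fubini_study_complex_row -/n.
have -> : \sum_k (yw k * xv k - xw k * yv k) =
   - \sum_k (yv k * xw k - xv k * yw k).
  by rewrite -sumrN; apply: eq_bigr => k _; ring.
have -> : \sum_k (y k * xw k - x k * yw k) = - \sum_k (yw k * x k - xw k * y k).
  by rewrite -sumrN; apply: eq_bigr => k _; ring.
have -> : \sum_k (x k * xw k + y k * yw k) = \sum_k (xw k * x k + yw k * y k).
  by apply: eq_bigr => k _; ring.
by field.
Qed.

Lemma curl_potential (R : realType) (V : normedModType R) N (U : set V)
    (X Y : 'I_N.+1 -> V -> R) v w x :
  open U -> (forall k, smooth_on U (X k)) -> (forall k, smooth_on U (Y k)) ->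
  U x -> \sum_k (X k x * X k x + Y k x * Y k x) != 0 ->
  'D_v (fubini_study_potential X Y w) x - 'D_w (fubini_study_potential X Y v) x =
  fubini_study (complex_row (X ^~ x) (Y ^~ x))
    (complex_row (fun k => 'D_v (X k) x) (fun k => 'D_v (Y k) x))
    (complex_row (fun k => 'D_w (X k) x) (fun k => 'D_w (Y k) x)).
Proof.
move=> oU sX sY Ux n0.
rewrite (derive_potential (fun k => erefl) (fun k => erefl) oU sX sY Ux n0).
rewrite (derive_potential (fun k => schwarz _ _ oU (sX k 2%N) Ux)
  (fun k => schwarz _ _ oU (sY k 2%N) Ux) oU sX sY Ux n0).
exact: (fubini_study_curl (x := X ^~ x) (y := Y ^~ x) _ _ _ _
  (fun k => 'D_v ('D_w (X k)) x) (fun k => 'D_v ('D_w (Y k)) x) n0).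
Qed.

(** * Linear algebra of the degenerate twistor deformation *)

Lemma to_complexM (R : realType) m n p (A : 'M[R]_(m, n)) (B : 'M[R]_(n, p)) :
  to_complex (A *m B) = to_complex A *m to_complex B.
Proof. exact: map_mxM. Qed.

Lemma to_complexD_inj (R : realType) m n (A A' B B' : 'M[R]_(m, n)) :
  to_complex A + 'i%C *: to_complex B = to_complex A' + 'i%C *: to_complex B' ->
  A = A' /\ B = B'.
Proof.
move=> E; suff H i j : A i j = A' i j /\ B i j = B' i j.
  by split; apply/matrixP => i j; have [] := H i j.
by move/matrixP/(_ i j): E; rewrite !mxE; simpc => -[-> ->].
Qed.

Lemma bilE (R : realType) d (A : 'M[R]_d) u v J :
  bil A u (v *m J) = bil (A *m J^T) u v.
Proof. by rewrite /bil trmx_mul !mulmxA. Qed.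

(** The Cauchy-Schwarz argument: with [w = u S], the polynomial
    [s |-> S(u + s w, u + s w)] is nonnegative and has no constant term, so its
    linear coefficient, twice the square norm of [w], vanishes. *)
Lemma psd_kernel (R : realType) d (S : 'M[R]_d) (u : 'rV[R]_d) :
  S^T = S -> (forall v, 0 <= bil S v v) -> bil S u u = 0 -> u *m S = 0.
Proof.
move=> symS S0 Su; have [w wE] : exists w, w = u *m S by exists (u *m S).
rewrite -wE.
have bilD a b a' b' : bil S (a + b) (a' + b') =
    bil S a a' + bil S a b' + (bil S b a' + bil S b b').
  by rewrite /bil linearD/= !(mulmxDl, mulmxDr) !mxE; ring.
have bilZ s a b : bil S (s *: a) b = s * bil S a b.
  by rewrite /bil -!scalemxAl mxE.
have bilZr s a b : bil S a (s *: b) = s * bil S a b.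
  by rewrite /bil linearZ/= -scalemxAr mxE.
have bilC a b : bil S a b = bil S b a.
  have : (b *m S *m a^T)^T = a *m S *m b^T.
    by rewrite !trmx_mul trmxK symS mulmxA.
  by move=> /matrixP/(_ 0 0); rewrite mxE => E; rewrite /bil E.
pose q := bil S w w.
have ww : bil S u w = \sum_k w 0 k ^+ 2.
  by rewrite /bil -wE mxE; apply: eq_bigr => k _; rewrite mxE -expr2.
pose n := \sum_k w 0 k ^+ 2; rewrite -/n in ww.
have n0 : 0 <= n by rewrite /n sumr_ge0// => k _; exact: sqr_ge0.
have ineq s : 0 <= 2 * s * n + s ^+ 2 * q.
  have := S0 (u + s *: w); rewrite bilD Su !bilZr !bilZ (bilC w u) ww -/q.
  by rewrite add0r => H; apply: le_trans H _;
    rewrite le_eqVlt; apply/orP; left; apply/eqP; ring.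
have q0 : 0 <= q by exact: S0.
have : n = 0.
  (* near the minimum - n / q of the polynomial, but defined also for q = 0 *)
  apply/eqP; have := ineq (- (n / (q + 1))).
  have q1 : 0 < q + 1 by lra.
  have -> : 2 * - (n / (q + 1)) * n + (- (n / (q + 1))) ^+ 2 * q =
    - (n ^+ 2 * (q + 2) / (q + 1) ^+ 2) by field; rewrite gt_eqF.
  rewrite oppr_ge0 pmulr_lle0 ?invr_gt0 ?exprn_gt0// pmulr_lle0; last lra.
  by move=> n20; rewrite -sqrf_eq0 eq_le sqr_ge0 n20.
move=> /eqP; rewrite psumr_eq0; last by move=> k _; exact: sqr_ge0.
move=> /allP w0; apply/rowP => k; rewrite mxE.
by have := w0 k (mem_index_enum k); rewrite sqrf_eq0 => /eqP.
Qed.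

(** The pointwise argument: [key] says that (0,1)-vectors of [It] are killed by the
    deformed form, and comparing types in [XOm] yields [ItE]. *)
Lemma degenerate_twistor_linear (R : realType) d (I It E : 'M[R]_d)
    (Om : 'M[R[i]]_d) (t : R[i]) :
  I *m I = - 1%:M -> It *m It = - 1%:M ->
  to_complex I *m Om = 'i%C *: Om -> Om^T = - Om ->
  (forall v : 'rV[R]_d, to_complex v *m Om = 0 -> v = 0) ->
  E^T = - E -> I *m E *m I^T = E -> (forall v, 0 <= bil E v (v *m I)) ->
  (forall v : 'rV[R[i]]_d, v *m to_complex It = - 'i%C *: v ->
     v *m (Om + t *: to_complex E) = 0) ->
  (forall u, 0 <= bil E u (u *m It)) /\
  (forall u, bil E u (u *m It) = 0 -> u *m It = u *m I).
Proof.
move=> II ItIt IOm OmT ndOm ET IE E0 kerOm.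
have ii : 'i%C * 'i%C = -1 :> R[i] by simpc.
have EIT : E *m I^T = - (I *m E).
  by rewrite -[in RHS]IE !mulmxA II mulNmx mul1mx mulNmx opprK.
(* 1 + i It maps onto the vectors of type (0,1) for It *)
have key : (1%:M + 'i%C *: to_complex It) *m (Om + t *: to_complex E) = 0.
  apply/row_matrixP => k; rewrite row_mul row0; apply: kerOm.
  rewrite -row_mul -linearZ; congr row.
  rewrite mulmxDl mul1mx -scalemxAl -to_complexM ItIt scalerDr scalerA mulNr ii.
  by rewrite opprK scale1r /to_complex map_mxN map_mx1 scalerN scaleNr addrC.
have XOm : to_complex (It - I) *m Om =
    'i%C *: (t *: (to_complex E + 'i%C *: to_complex (It *m E))).
  move: key; rewrite mulmxDl mul1mx -scalemxAl mulmxDr scalerDr -!scalemxAr.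
  rewrite -to_complexM => key.
  rewrite /to_complex map_mxB mulmxBl -/(to_complex I) IOm.
  have -> : map_mx (real_complex R) It *m Om =
      'i%C *: (Om + t *: (to_complex E + 'i%C *: to_complex (It *m E))).
    rewrite -/(to_complex It).
    have -> : Om + t *: (to_complex E + 'i%C *: to_complex (It *m E)) =
        - ('i%C *: (to_complex It *m Om)).
      apply/eqP; rewrite -addr_eq0 scalerDr (scalerA t) (mulrC t) -scalerA addrA.
      by rewrite -key -!addrA; apply/eqP; congr (_ + (_ + _)); rewrite addrC.
    by rewrite scalerN scalerA ii scaleN1r opprK.
  by rewrite -scalerBr addrC addKr.
have OmIT : Om *m (to_complex I)^T = 'i%C *: Om.
  apply: trmx_inj; rewrite trmx_mul trmxK linearZ/= OmT mulmxN IOm.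
  by rewrite scalerN.
have i0 : 'i%C != 0 :> R[i] by rewrite eq_complex/= oner_eq0 andbF.
have ItE : It *m E = I *m E.
  have [t0|t0] := eqVneq t 0.
    suff /eqP : It - I = 0 by rewrite subr_eq0 => /eqP ->.
    apply/row_matrixP => k; rewrite row0; apply: ndOm.
    by rewrite rowE to_complexM -mulmxA XOm t0 scale0r scaler0 mulmx0.
  have : to_complex (It - I) *m Om *m (to_complex I)^T =
      'i%C *: (to_complex (It - I) *m Om) by rewrite -mulmxA OmIT scalemxAr.
  rewrite XOm -!scalemxAl => /(scalerI i0).
  rewrite scalerA (mulrC _ t) -scalerA => /(scalerI t0).
  rewrite mulmxDl -scalemxAl /to_complex map_trmx -!map_mxM scalerDr scalerA ii scaleN1r.
  rewrite addrC [in RHS]addrC [in LHS]addrC -map_mxN => /to_complexD_inj[+ _].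
  by rewrite EIT => /oppr_inj.
have EItT : E *m It^T = E *m I^T.
  by apply: trmx_inj; rewrite !trmx_mul !trmxK ET !mulmxN ItE.
split=> u; rewrite bilE EItT -bilE; first exact: E0.
move=> Eu; have uEI : u *m (E *m I^T) = 0.
  apply: psd_kernel => [|v|]; last by rewrite -bilE.
    by rewrite trmx_mul trmxK ET mulmxN EIT.
  by rewrite -bilE.
have uE : u *m E = 0.
  have ITIT : I^T *m I^T = - 1%:M by rewrite -trmx_mul II linearN/= trmx1.
  transitivity (- (u *m (E *m I^T) *m I^T)); last by rewrite uEI mul0mx oppr0.
  by rewrite -!mulmxA ITIT !mulmxN mulmx1 opprK.
have uIE : u *m (I *m E) = 0 by rewrite -[I *m E]opprK -EIT mulmxN uEI oppr0.
apply/eqP; rewrite -subr_eq0 -mulmxBr; apply/eqP; apply: ndOm.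
rewrite to_complexM -mulmxA XOm -!scalemxAr mulmxDr -scalemxAr -!to_complexM.
by rewrite ItE uE uIE /to_complex !map_mx0 scaler0 addr0 !scaler0.
Qed.

(** * Compactness of the set of directions *)

Lemma cvg_coord (R : realType) (T : Type) (F : set_system T) m n
    (A : T -> 'M[R]_(m, n)) (a : 'M[R]_(m, n)) i j : Filter F ->
  A t @[t --> F] --> a -> A t i j @[t --> F] --> a i j.
Proof.
move=> FF cA.
exact: (cvg_comp A (fun B : 'M[R]_(m, n) => B i j) cA (@coord_continuous _ _ _ i j a)).
Qed.

Lemma cvg_mulmx (R : realType) (T : Type) (F : set_system T) m n p
    (A : T -> 'M[R]_(m, n)) (B : T -> 'M[R]_(n, p))
    (a : 'M[R]_(m, n)) (b : 'M[R]_(n, p)) : Filter F ->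
  A t @[t --> F] --> a -> B t @[t --> F] --> b ->
  (A t *m B t) @[t --> F] --> a *m b.
Proof.
move=> FF cA cB; apply: cvg_mx => i j; rewrite mxE.
under eq_fun do rewrite mxE.
apply: cvg_big => [|k _]; first exact: add_continuous.
apply: cvgM.
  exact: cvg_coord.
exact: cvg_coord.
Qed.

Lemma cvg_bil (R : realType) (T : Type) (F : set_system T) d
    (A : T -> 'M[R]_d) (u : T -> 'rV[R]_d) (a : 'M[R]_d)
    (u0 : 'rV[R]_d) : Filter F ->
  A t @[t --> F] --> a -> u t @[t --> F] --> u0 ->
  bil (A t) (u t) (u t) @[t --> F] --> bil a u0 u0.
Proof.
move=> FF cA cu; have cuT : (u t)^T @[t --> F] --> u0^T.
  apply: cvg_mx => i j; rewrite mxE; under eq_fun do rewrite mxE.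
  exact: cvg_coord.
apply: (@cvg_coord _ _ _ _ _ (fun t => u t *m A t *m (u t)^T) (u0 *m a *m u0^T)).
by apply: cvg_mulmx => //; exact: cvg_mulmx.
Qed.

Lemma compact_sphere (R : realType) d : compact [set v : 'rV[R]_d | `|v| = 1].
Proof.
apply: bounded_closed_compact.
  by exists 1; split=> // r r1 v /= ->; exact: ltW.
rewrite (_ : [set v | _] = (fun v : 'rV[R]_d => `|v|) @^-1` [set 1]) //.
by apply: closed_comp; [move=> v _; exact: norm_continuous|exact: closed_eq].
Qed.

(** If the semidefinite form [E x] is positive wherever [W x0] is not, then a
    large multiple of it compensates the defect of [W], uniformly near [x0],
    because the directions form a compact set. *)
Lemma near_positive (R : realType) d (V : topologicalType) (W E : V -> 'M[R]_d) x0 :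
  {for x0, continuous W} -> {for x0, continuous E} ->
  (\forall x \near x0, forall v, 0 <= bil (E x) v v) ->
  (forall v, v != 0 -> bil (E x0) v v = 0 -> 0 < bil (W x0) v v) ->
  \forall x \near x0 & C \near +oo, forall v, v != 0 ->
    0 < bil (W x) v v + C * bil (E x) v v.
Proof.
move=> cW cE E0 W0.
have : \forall i \near filter_prod (nbhs x0) (pinfty_nbhs R),
    [set v : 'rV[R]_d | `|v| = 1] `<=`
    [set v | 0 < bil (W i.1) v v + i.2 * bil (E i.1) v v].
  apply: ((compact_near_coveringP _).1 (@compact_sphere R d)) => v0 v01.
  pose F := filter_prod (nbhs v0) (filter_prod (nbhs x0) (pinfty_nbhs R)).
  have FF : Filter F by exact: _.
  have cv : z.1 @[z --> F] --> v0 by exact: cvg_fst.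
  have cx : z.2.1 @[z --> F] --> x0 by exact: (cvg_comp _ _ cvg_snd cvg_fst).
  have q0 : bil (W z.2.1) z.1 z.1 @[z --> F] --> bil (W x0) v0 v0.
    by apply: cvg_bil => //; exact: (cvg_comp _ _ cx cW).
  have q1 : bil (E z.2.1) z.1 z.1 @[z --> F] --> bil (E x0) v0 v0.
    by apply: cvg_bil => //; exact: (cvg_comp _ _ cx cE).
  have C0 (c : R) : \forall z \near F, c < z.2.2.
    have cC : z.2.2 @[z --> F] --> +oo by exact: (cvg_comp _ _ cvg_snd cvg_snd).
    by exact: (cC _ (nbhs_pinfty_gt (num_real c))).
  have E0F : \forall z \near F, forall v, 0 <= bil (E z.2.1) v v by exact: (cx _ E0).
  suff : \forall z \near F, 0 < bil (W z.2.1) z.1 z.1 + z.2.2 * bil (E z.2.1) z.1 z.1.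
    by [].
  have := nbhs_singleton E0 v0; rewrite le_eqVlt => /orP[/eqP/esym Ev0|Ev0].
    have W0F : \forall z \near F, 0 < bil (W z.2.1) z.1 z.1.
      apply: (cvgr_gt _ q0); apply: W0 => //.
      by rewrite -normr_eq0 v01 oner_neq0.
    apply: filterS3 W0F E0F (C0 0) => z Wz Ez Cz.
    by rewrite ltr_wpDr// mulr_ge0// ltW.
  pose e := bil (E x0) v0 v0; pose w := bil (W x0) v0 v0.
  have E1F : \forall z \near F, e / 2 < bil (E z.2.1) z.1 z.1.
    by apply: (cvgr_gt _ q1); rewrite ltr_pdivrMr// mulr_natr mulr2n ltrDl.
  have W1F : \forall z \near F, w - 1 < bil (W z.2.1) z.1 z.1.
    by apply: (cvgr_gt _ q0); rewrite ltrBlDr ltrDl.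
  have C1F := C0 ((1 + `|w|) / (e / 2)).
  apply: filterS3 E1F W1F C1F => z Ez Wz Cz.
  have e2 : 0 < e / 2 by rewrite divr_gt0.
  have C0z : 0 < z.2.2 by apply: le_lt_trans Cz; rewrite divr_ge0// ltW.
  have : 1 + `|w| < z.2.2 * bil (E z.2.1) z.1 z.1.
    rewrite ltr_pdivrMr// in Cz; apply: lt_trans Cz _.
    by rewrite ltr_pM2l.
  have := ler_norm (- w); rewrite normrN; lra.
apply: filterS => -[x C] /= H v v0.
have nv : 0 < `|v| by rewrite normr_gt0.
have := H (`|v|^-1 *: v); rewrite /= normrZ normfV normr_id mulVf ?gt_eqF//.
move=> /(_ erefl).
have bilZZ (S : 'M[R]_d) s : bil S (s *: v) (s *: v) = s ^+ 2 * bil S v v.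
  by rewrite /bil linearZ/= -scalemxAr -!scalemxAl !mxE mulrA.
by rewrite !bilZZ mulrCA -mulrDr pmulr_rgt0// exprn_gt0// invr_gt0.
Qed.

(** * The pulled back form on the manifold *)

Lemma bil_e (R : realType) d (A : 'M[R]_d) j k : bil A (e_ R j) (e_ R k) = A j k.
Proof. by rewrite /bil /e_ -rowE trmx_delta -colE !mxE. Qed.

Lemma eq_bil (R : realType) d (A B : 'M[R]_d) :
  (forall u v, bil A u v = bil B u v) -> A = B.
Proof. by move=> AB; apply/matrixP => j k; rewrite -!bil_e. Qed.

Lemma bil_bil_in (R : realType) d (M : manifold R d) (c : chart R d M)
    (w : M -> 'M[R]_d) x u v :
  bil (bil_in c w x) u v =
  bil (w (param c x)) (u *m frame c (param c x)) (v *m frame c (param c x)).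
Proof. by rewrite /bil /bil_in trmx_mul !mulmxA. Qed.

Definition re_lift (R : realType) d (M : manifold R d) N (c : chart R d M)
  (F : M -> 'rV[R[i]]_N) (k : 'I_N) (x : 'rV[R]_d) : R :=
  complex.Re (F (param c x) 0 k).
Definition im_lift (R : realType) d (M : manifold R d) N (c : chart R d M)
  (F : M -> 'rV[R[i]]_N) (k : 'I_N) (x : 'rV[R]_d) : R :=
  complex.Im (F (param c x) 0 k).

(** Homogeneous coordinates do not vanish simultaneously, so the potential has no
    pole. *)
Lemma lift_norm_neq0 (R : realType) m (M : manifold R (m + m)) N I
    (pi : M -> proj_space R N) U F (c : chart R (m + m) M) x :
  holomorphic_lift I pi U F -> U (param c x) ->
  \sum_k (re_lift c F k x * re_lift c F k x + im_lift c F k x * im_lift c F k x)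
    != 0.
Proof.
move=> [_ FU] /FU[F0 _]; apply: contra_neq F0 => n0; apply: hdot_eq0.
have -> : F (param c x) = complex_row (re_lift c F ^~ x) (im_lift c F ^~ x).
  by apply/rowP => k; rewrite mxE /re_lift /im_lift; case: (F _ 0 k).
rewrite hdot_complex_row n0; congr Complex.
by apply: big1 => k _; rewrite mulrC subrr.
Qed.

Lemma smooth_on_re_lift (R : realType) m (M : manifold R (m + m)) N I
    (pi : M -> proj_space R N) U F (c : chart R (m + m) M) k :
  holomorphic_lift I pi U F -> smooth_chart c ->
  smooth_on (coords c @` (dom c `&` U)) (re_lift c F k).
Proof. by move=> [hF _] sc; have [sF _ _] := hF k; exact: sF. Qed.

Lemma smooth_on_im_lift (R : realType) m (M : manifold R (m + m)) N I
    (pi : M -> proj_space R N) U F (c : chart R (m + m) M) k :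
  holomorphic_lift I pi U F -> smooth_chart c ->
  smooth_on (coords c @` (dom c `&` U)) (im_lift c F k).
Proof. by move=> [hF _] sc; have [_ sF _] := hF k; exact: sF. Qed.

Lemma pullback_in_chart (R : realType) m (M : manifold R (m + m)) N I
    (pi : M -> proj_space R N) eta U F (c : chart R (m + m) M) x j k :
  fubini_study_pullback I pi eta -> open U -> holomorphic_lift I pi U F ->
  smooth_chart c -> (coords c @` (dom c `&` U)) x ->
  bil_in c eta x j k =
  'D_(e_ R j) (fubini_study_potential (re_lift c F) (im_lift c F) (e_ R k)) x
  - 'D_(e_ R k) (fubini_study_potential (re_lift c F) (im_lift c F) (e_ R j)) x.
Proof.
move=> etaE oU lF sc Ox; have := Ox => -[p [dp Up] px].
have xp : param c x = p by rewrite -px coordK.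
rewrite (curl_potential _ _ (open_coords (c := c) oU)
  (fun k => smooth_on_re_lift k lF sc) (fun k => smooth_on_im_lift k lF sc) Ox);
  last by apply: lift_norm_neq0 lF _; rewrite xp.
rewrite -bil_e bil_bil_in xp (etaE U F oU lF p Up) /=.
have row_frame v : \row_k cdfun (fun q => F q 0 k) p (v *m frame c p) =
    complex_row (fun k => 'D_v (re_lift c F k) x) (fun k => 'D_v (im_lift c F k) x).
  apply/rowP => l; rewrite !mxE /cdfun; have [sR sI _] := lF.1 l.
  by rewrite (dfun_frame v sc oU sR dp Up) (dfun_frame v sc oU sI dp Up) px.
have Fp : F p = complex_row (re_lift c F ^~ x) (im_lift c F ^~ x).
  by apply/rowP => l; rewrite mxE /re_lift /im_lift xp; case: (F p 0 l).
by rewrite Fp !row_frame.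
Qed.

(** All that the smoothness and the closedness of [eta] require of the lifts of
    [pi]: the forms [a] are primitives of [eta] near [x]. *)
Lemma pullback_local (R : realType) m (M : manifold R (m + m)) N I
    (pi : M -> proj_space R N) eta (c : chart R (m + m) M) x :
  holomorphic_to_proj I pi -> fubini_study_pullback I pi eta ->
  smooth_chart c -> chart_image c x ->
  exists Q (a : 'I_(m + m) -> 'rV[R]_(m + m) -> R),
    [/\ open Q, Q x, forall k, smooth_on Q (a k) &
      forall y j k, Q y ->
        bil_in c eta y j k = 'D_(e_ R j) (a k) y - 'D_(e_ R k) (a j) y].
Proof.
move=> hpi etaE sc [p dp px]; have [U [F [oU Up lF]]] := hpi p.
exists (coords c @` (dom c `&` U)),
  (fun k => fubini_study_potential (re_lift c F) (im_lift c F) (e_ R k)).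
split; [exact: open_coords|by exists p|move=> k|].
  apply: smooth_on_potential; first exact: open_coords.
  - by move=> l; exact: smooth_on_re_lift lF sc.
  - by move=> l; exact: smooth_on_im_lift lF sc.
  by move=> _ [q [dq Uq] <-]; apply: lift_norm_neq0 lF _; rewrite coordK.
by move=> y j k Oy; exact: pullback_in_chart etaE oU lF sc Oy.
Qed.

Lemma pullback_smooth (R : realType) m (M : manifold R (m + m)) N I
    (pi : M -> proj_space R N) eta :
  holomorphic_to_proj I pi -> fubini_study_pullback I pi eta -> smooth_bil eta.
Proof.
move=> hpi etaE c sc k; apply: Ck_on_cover => x ix.
have [Q [a [oO Ox sa aE]]] := pullback_local hpi etaE sc ix.
exists Q => //; apply: Ck_on_mx => // j l.
apply: (Ck_on_eq (f := fun y => 'D_(e_ R j) (a l) y - 'D_(e_ R l) (a j) y)) => //.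
  by move=> y Oy; rewrite aE.
by apply: Ck_onD => //; [|apply: Ck_onN => //]; exact: smooth_on_derive.
Qed.

Lemma pullback_closed (R : realType) m (M : manifold R (m + m)) N I
    (pi : M -> proj_space R N) eta :
  holomorphic_to_proj I pi -> fubini_study_pullback I pi eta -> closed_form eta.
Proof.
move=> hpi etaE c sc x ix i j k.
have [Q [a [oO Ox sa aE]]] := pullback_local hpi etaE sc ix.
have D l r s : 'D_(e_ R l) (fun y => bil_in c eta y r s : R) x =
    'D_(e_ R l) ('D_(e_ R r) (a s)) x - 'D_(e_ R l) ('D_(e_ R s) (a r)) x.
  transitivity ('D_(e_ R l) ('D_(e_ R r) (a s) - 'D_(e_ R s) (a r)) x).
    apply: near_eq_derive.
    by apply: filterS (open_nbhs_nbhs (conj oO Ox)) => y Oy; rewrite aE.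
  by rewrite deriveB//; exact: (Ck_on_derivable (smooth_on_derive _ (sa _) 1%N) Ox).
have S l r s := schwarz (e_ R l) (e_ R r) oO (sa s 2%N) Ox.
have cancel (x1 x2 x3 y1 y2 y3 : R) : y2 = x1 -> y3 = x2 -> y1 = x3 ->
    x1 - y1 + (x2 - y2) + (x3 - y3) = 0 by move=> -> -> ->; ring.
by rewrite !D; apply: cancel; exact: S.
Qed.

Lemma pullbackN (R : realType) m (M : manifold R (m + m)) N I
    (pi : M -> proj_space R N) eta p :
  holomorphic_to_proj I pi -> fubini_study_pullback I pi eta ->
  (eta p)^T = - eta p.
Proof.
move=> hpi etaE; have [U [F [oU Up lF]]] := hpi p.
apply/matrixP => j k; rewrite !mxE -!bil_e !(etaE U F oU lF p Up) /=.
exact: fubini_studyC.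
Qed.

(** Since [F] is holomorphic, [dF (I v) = i dF v], and both properties are
    inherited from the Fubini-Study form. *)
Lemma pullback_type11 (R : realType) m (M : manifold R (m + m)) N I
    (pi : M -> proj_space R N) eta p :
  holomorphic_to_proj I pi -> fubini_study_pullback I pi eta ->
  I p *m eta p *m (I p)^T = eta p /\ forall v, 0 <= bil (eta p) v (v *m I p).
Proof.
move=> hpi etaE; have [U [F [oU Up lF]]] := hpi p.
pose dF v := \row_k cdfun (fun q => F q 0 k) p v.
have etaF u v : bil (eta p) u v = fubini_study (F p) (dF u) (dF v).
  exact: etaE U F oU lF p Up u v.
have dFI v : dF (v *m I p) = 'i%C *: dF v.
  by apply/rowP => k; rewrite !mxE; have [_ _ ->] := lF.1 k.
clearbody dF; split=> [|v]; last by rewrite etaF dFI; exact: fubini_study_ge0.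
apply: eq_bil => u v.
have -> : bil (I p *m eta p *m (I p)^T) u v = bil (eta p) (u *m I p) (v *m I p).
  by rewrite /bil trmx_mul !mulmxA.
by rewrite !etaF !dFI fubini_study_mulI.
Qed.

(** * The pencil spanned by a Kaehler form and the pulled back form *)

Lemma std_J_sq (R : realType) m : std_J R m *m std_J R m = - 1%:M.
Proof.
rewrite /std_J mulmx_block !mul0mx !mulmx0 !mul1mx !mulmx1 !add0r !addr0.
by rewrite -[0]oppr0 -opp_block_mx -scalar_mx_block.
Qed.

Lemma frame_holomorphic (R : realType) m (M : manifold R (m + m))
    (I : M -> 'M[R]_(m + m)) (c : chart R (m + m) M) p :
  holomorphic_chart I c -> dom c p ->
  frame c p *m I p = std_J R m *m frame c p.
Proof.
move=> [sc hc] dp; have ip : chart_image c (coords c p) by exists p.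
rewrite -(hc _ ip) /endo_in coordK// mulmxKV//; exact: frame_unit.
Qed.

Lemma complex_structure_sq (R : realType) m (M : manifold R (m + m))
    (I : M -> 'M[R]_(m + m)) p :
  complex_structure I -> I p *m I p = - 1%:M.
Proof.
move=> /(_ p)[c [hc dp]]; have fu := frame_unit hc.1 dp.
have fI := frame_holomorphic hc dp.
apply: (can_inj (mulKmx fu)).
by rewrite mulmxA fI -mulmxA fI mulmxA std_J_sq mulNmx mul1mx mulmxN mulmx1.
Qed.

Lemma bil_pencil (R : realType) d (A B : 'M[R]_d) C u v :
  bil (A + C *: B) u v = bil A u v + C * bil B u v.
Proof. by rewrite /bil mulmxDr mulmxDl -scalemxAr -scalemxAl !mxE. Qed.

Lemma bil_in_pencil (R : realType) d (M : manifold R d) (c : chart R d M)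
    (w eta : M -> 'M[R]_d) (C : R) x :
  bil_in c (fun p => w p + C *: eta p) x = bil_in c w x + C *: bil_in c eta x.
Proof. by apply: eq_bil => u v; rewrite bil_pencil !bil_bil_in bil_pencil. Qed.

Lemma smooth_on_bil_in (R : realType) d (M : manifold R d) (c : chart R d M)
    (w : M -> 'M[R]_d) j k :
  smooth_bil w -> smooth_chart c ->
  smooth_on (chart_image c) (fun x => bil_in c w x j k : R).
Proof.
by move=> sw sc r; apply: Ck_on_coord; [exact: open_chart_image|exact: sw].
Qed.

Lemma two_form_pencil (R : realType) d (M : manifold R d) (w eta : M -> 'M[R]_d)
    (C : R) :
  two_form w -> two_form eta -> two_form (fun p => w p + C *: eta p).
Proof.
move=> [sw aw] [se ae]; split=> [c sc r|p]; last first.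
  by rewrite linearD linearZ/= aw ae scalerN opprD.
have oI : open (chart_image c) by exact: open_chart_image.
apply: Ck_on_mx => // j k.
apply: (Ck_on_eq (f := fun x => bil_in c w x j k + C * bil_in c eta x j k)) => //.
  by move=> x _; rewrite bil_in_pencil !mxE.
apply: Ck_onD => //; first exact: smooth_on_bil_in.
by apply: (Ck_onM (f := cst C)) => //; [exact: Ck_on_cst|exact: smooth_on_bil_in].
Qed.

Lemma closed_form_pencil (R : realType) d (M : manifold R d)
    (w eta : M -> 'M[R]_d) (C : R) :
  two_form w -> two_form eta -> closed_form w -> closed_form eta ->
  closed_form (fun p => w p + C *: eta p).
Proof.
move=> [sw _] [se _] cw ce c sc x ix i j k.
have D l r s : 'D_(e_ R l) (fun y => bil_in c (fun p => w p + C *: eta p) y r s : R) x =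
    'D_(e_ R l) (fun y => bil_in c w y r s : R) x
    + C * 'D_(e_ R l) (fun y => bil_in c eta y r s : R) x.
  have dw := Ck_on_derivable (v := e_ R l) (smooth_on_bil_in r s sw sc 1%N) ix.
  have de := Ck_on_derivable (v := e_ R l) (smooth_on_bil_in r s se sc 1%N) ix.
  transitivity ('D_(e_ R l) ((fun y => bil_in c w y r s : R)
    + (C *: (fun y => bil_in c eta y r s : R))) x).
    have oI : open (chart_image c) by exact: open_chart_image.
    apply: near_eq_derive; apply: filterS (open_nbhs_nbhs (conj oI ix)) => y _.
    by rewrite bil_in_pencil mxE [X in _ + X]mxE.
  have [_ E] := is_deriveD (derivableP dw) (is_deriveZ C (derivableP de)).
  exact: E.
have cancel (x1 x2 x3 y1 y2 y3 : R) : x1 + x2 + x3 = 0 -> y1 + y2 + y3 = 0 ->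
    x1 + C * y1 + (x2 + C * y2) + (x3 + C * y3) = 0.
  move=> X0 Y0; transitivity (x1 + x2 + x3 + C * (y1 + y2 + y3)); first by ring.
  by rewrite X0 Y0 mulr0 addr0.
by rewrite !D; apply: cancel; [exact: cw|exact: ce].
Qed.

(** A vector in the kernel of [A] would violate positivity. *)
Lemma tame_unitmx (R : realType) d (A J : 'M[R]_d) :
  (forall v, v != 0 -> 0 < bil A v (v *m J)) -> A \in unitmx.
Proof.
move=> tameA; rewrite -row_free_unit -kermx_eq0; apply/negPn/negP.
move=> /rowV0Pn[v /sub_kermxP vA v0]; have := tameA v v0.
by rewrite /bil vA mul0mx mxE ltxx.
Qed.

(** In a holomorphic chart of [It] the complex structure is constant, so that
    only the components of [w] and [eta] vary. *)
Lemma near_tame (R : realType) m (M : manifold R (m + m))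
    (It w eta : M -> 'M[R]_(m + m)) p :
  complex_structure It -> smooth_bil w -> smooth_bil eta ->
  (forall q v, 0 <= bil (eta q) v (v *m It q)) ->
  (forall q v, v != 0 -> bil (eta q) v (v *m It q) = 0 ->
    0 < bil (w q) v (v *m It q)) ->
  \forall q \near (p : points M) & C \near +oo, forall v, v != 0 ->
    0 < bil (w q + C *: eta q) v (v *m It q).
Proof.
move=> /(_ p)[c [hc dp]] sw se eta0 w0; have sc := hc.1.
have oI : open (chart_image c) by exact: open_chart_image.
have ip : chart_image c (coords c p) by exists p.
pose form (a : M -> 'M[R]_(m + m)) x := bil_in c a x *m (std_J R m)^T.
have formE a q v : dom c q ->
    bil (form a (coords c q)) v v = bil (a q) (v *m frame c q) (v *m frame c q *m It q).
  move=> dq; rewrite -bilE bil_bil_in coordK//.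
  by rewrite -!mulmxA (frame_holomorphic hc dq).
have cform a : smooth_bil a -> {for coords c p, continuous (form a)}.
  move=> sa; apply: (@cvg_mulmx _ _ (nbhs (coords c p))).
    exact: (Ck_on_continuous (sa c sc 0) ip).
  exact: cst_continuous.
have [|v v0|[A B] /= [nA nB] AB] :=
    near_positive (cform _ sw) (cform _ se).
- apply: filterS (open_nbhs_nbhs (conj oI ip)) => _ [q dq <-] v.
  by rewrite formE.
- rewrite !formE//; apply: w0; apply: contra_neq v0 => vf.
  by rewrite -[v](mulmxK (frame_unit sc dp)) vf mul0mx.
exists (dom c `&` (coords c @^-1` A), B).
  split=> //=; apply: filterI; last exact: (continuous_coord dp).
  by apply: open_nbhs_nbhs; split=> //; exact: open_dom.
move=> [q C] /= [[dq Aq] BC] v v0.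
have := AB (coords c q, C) (conj Aq BC) (v *m invmx (frame c q)).
rewrite /= !formE// mulmxKV ?frame_unit// bil_pencil; apply.
apply: contra_neq v0 => vf.
by rewrite -[v](mulmxKV (frame_unit sc dq)) vf mul0mx.
Qed.

Lemma complex_form_tr (R : realType) d (M : manifold R d) (Om : M -> 'M[R[i]]_d) p :
  complex_two_form Om -> (Om p)^T = - Om p.
Proof.
move=> [[_ /(_ p)/matrixP aRe] [_ /(_ p)/matrixP aIm]].
apply/matrixP => j k; have := aRe j k; have := aIm j k; rewrite !mxE.
by case: (Om p k j) => a b; case: (Om p j k) => a' b' /= -> ->.
Qed.

Theorem theorem3p4 (R : realType) (n N : nat)
    (M : manifold R ((n + n) + (n + n)))
    (I : M -> 'M[R]_((n + n) + (n + n)))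
    (Om : M -> 'M[R[i]]_((n + n) + (n + n)))
    (B : set (proj_space R N)) (pi : M -> proj_space R N)
    (eta : M -> 'M[R]_((n + n) + (n + n))) :
  hyperkaehler I Om ->
  maximal_holonomy I ->
  simply_connected R M ->
  lagrangian_fibration I B pi ->
  fubini_study_pullback I pi eta ->
  forall (t : R[i]) (It : M -> 'M[R]_((n + n) + (n + n))),
    determined_by (degenerate_twistor_form Om eta t) It ->
    exists w : M -> 'M[R]_((n + n) + (n + n)), hermitian_symplectic It w.
Proof.
move=> [cM cI [om [[om2 omC _] _ omI]] [[Om2 IOm _] _ Omnd]] _ _.
move=> [_ _ hpi _] etaE t It [cIt kerIt].
have eta2 : two_form eta.
  by split=> [|p]; [exact: pullback_smooth hpi etaE|exact: pullbackN hpi etaE].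
have etaC : closed_form eta by exact: pullback_closed hpi etaE.
have lin q := degenerate_twistor_linear (complex_structure_sq q cI)
  (complex_structure_sq q cIt) (IOm q) (complex_form_tr q Om2) (@Omnd q)
  (pullbackN q hpi etaE) (pullback_type11 q hpi etaE).1
  (pullback_type11 q hpi etaE).2 (fun v => (kerIt q v).1).
have tame0 q v : v != 0 -> bil (eta q) v (v *m It q) = 0 ->
    0 < bil (om q) v (v *m It q).
  by move=> v0 /(lin q).2 ->; exact: omI.
pose tame (C : R) q := forall v, v != 0 ->
  0 < bil (om q + C *: eta q) v (v *m It q).
have near_tameC : \forall C \near +oo, [set: M] `<=` tame C.
  apply: ((compact_near_coveringP _).1 cM _ _ tame) => p _.
  exact: near_tame cIt om2.1 eta2.1 (fun q => (lin q).1) tame0.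
have [C tameC] := filter_ex near_tameC.
exists (fun p => om p + C *: eta p); split=> [|q v v0]; last exact: (tameC q).
split; [exact: two_form_pencil|exact: closed_form_pencil|move=> q].
by apply: tame_unitmx => v v0; exact: (tameC q).
Qed.
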